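(* Let $V$ be a DVR having quotient field $F$ of positive characteristic $p$. The following are equivalent. (1) $V$ is the normalization of an analytically ramified local Noetherian domain. (2) There exists a subfield $Q$ of $F$ such that $F = V + Q$ and $F \ne Q[F^p]$.
   Context: A DVR is a rank one discrete valuation ring. The normalization of a domain is its integral closure in its quotient field. A local Noetherian ring is analytically ramified if its completion in the topology of its maximal ideal has a nonzero nilpotent element. $F^p$ is the subfield of $p$-th powers of elements of $F$, and $Q[F^p]$ is the subfield of $F$ generated by $Q$ and $F^p$. $V+Q$ is the set of sums $v+q$ with $v\in V$, $q\in Q$. *)

(* Defs.v *)
From HB Require Import structures.
From mathcomp Require Import all_boot all_algebra.
From mathcomp Require Import boolp classical_sets functions.

Set Implicit Arguments.
Unset Strict Implicit.
Unset Printing Implicit Defensive.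

Import GRing.Theory.
Local Open Scope ring_scope.
Local Open Scope classical_set_scope.

Section Ideals.
Variable R : comNzRingType.
Implicit Types I M A : set R.

Definition ideal I := I 0 /\ forall a x y, I x -> I y -> I (a * x + y).

Definition ideal_span A : set R := smallest ideal A.

Lemma ideal_span_ideal A : ideal (ideal_span A).
Proof.
split=> [I [[I0 _] _] //|a x y Ix Iy I IA].
by case: (IA) => -[_ Icl] _; apply: Icl; [apply: Ix | apply: Iy].
Qed.

(* For n = 0 the only product is the empty one, so A^0 = R. *)
Definition ideal_exp A (n : nat) : set R :=
  ideal_span
    [set \prod_(i < n) a i | a in [set a : 'I_n -> R | forall i, A (a i)]].

Definition noetherian :=
  forall I, ideal I -> exists s : seq R, I = ideal_span [set` s].

Definition maximal_ideal M :=
  [/\ ideal M, M <> setT &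
      forall I, ideal I -> M `<=` I -> I = M \/ I = setT].

Definition local_ring := exists! M, maximal_ideal M.

End Ideals.

Arguments noetherian : clear implicits.
Arguments local_ring : clear implicits.

Section IdealExp.
Variables (R : comNzRingType) (A : set R) (n : nat).
Local Notation I := (ideal_exp A n).

Lemma ideal_exp_ideal : ideal I. Proof. exact: ideal_span_ideal. Qed.

Lemma ideal_exp0 : I 0. Proof. by case: ideal_exp_ideal. Qed.

Lemma ideal_expMD a x y : I x -> I y -> I (a * x + y).
Proof. by case: ideal_exp_ideal => _; apply. Qed.

Lemma ideal_expM a x : I x -> I (a * x).
Proof.
by move=> Ix; rewrite -[_ * _]addr0; apply: ideal_expMD => //; apply: ideal_exp0.
Qed.

Lemma ideal_expD x y : I x -> I y -> I (x + y).
Proof. by move=> Ix Iy; rewrite -[x]mul1r; apply: ideal_expMD. Qed.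

Lemma ideal_expB x y : I x -> I y -> I (x - y).
Proof. by move=> Ix Iy; rewrite addrC -mulN1r; apply: ideal_expMD. Qed.

End IdealExp.

Section CauchySequences.
Variables (R : comNzRingType) (A : set R).

Definition adic_cauchy : {pred nat -> R} := fun u =>
  `[< forall n, exists N, forall i j : nat,
        (N <= i)%N -> (N <= j)%N -> ideal_exp A n (u i - u j) >].

Lemma adic_cauchyP (u : nat -> R) :
  reflect (forall n, exists N, forall i j : nat,
             (N <= i)%N -> (N <= j)%N -> ideal_exp A n (u i - u j))
          (u \in adic_cauchy).
Proof. exact: asboolP. Qed.

Lemma adic_cauchy_subring : subring_closed adic_cauchy.
Proof.
split=> [|u v /adic_cauchyP cu /adic_cauchyP cv|u v /adic_cauchyP cu /adic_cauchyP cv];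
  apply/adic_cauchyP => n.
- by exists 0%N => i j _ _; rewrite subrr; apply: ideal_exp0.
- have [N1 h1] := cu n; have [N2 h2] := cv n.
  exists (maxn N1 N2) => i j; rewrite !geq_max => /andP[i1 i2] /andP[j1 j2].
  have -> : (u - v) i - (u - v) j = (u i - u j) - (v i - v j).
    change (u i - v i - (u j - v j) = (u i - u j) - (v i - v j)).
    by rewrite !opprD addrACA.
  by apply: ideal_expB; [apply: h1 | apply: h2].
- have [N1 h1] := cu n; have [N2 h2] := cv n.
  exists (maxn N1 N2) => i j; rewrite !geq_max => /andP[i1 i2] /andP[j1 j2].
  have -> : (u * v) i - (u * v) j = v i * (u i - u j) + u j * (v i - v j).
    change (u i * v i - u j * v j = v i * (u i - u j) + u j * (v i - v j)).
    by rewrite !mulrBr [v i * u i]mulrC [v i * u j]mulrC addrA subrK.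
  by apply: ideal_expD; apply: ideal_expM; [apply: h1 | apply: h2].
Qed.

HB.instance Definition _ :=
  GRing.isSubringClosed.Build (nat -> R) adic_cauchy adic_cauchy_subring.

Record cauchySeq := CauchySeq {
  cauchy_val :> nat -> R;
  _ : cauchy_val \in adic_cauchy
}.

HB.instance Definition _ := [isSub for cauchy_val].
HB.instance Definition _ := [Choice of cauchySeq by <:].
HB.instance Definition _ := [SubChoice_isSubComNzRing of cauchySeq by <:].

Definition adic_null : {pred cauchySeq} := fun u =>
  `[< forall n, exists N, forall i : nat, (N <= i)%N -> ideal_exp A n (u i) >].

Lemma adic_nullP (u : cauchySeq) :
  reflect (forall n, exists N, forall i : nat,
             (N <= i)%N -> ideal_exp A n (u i))
          (u \in adic_null).
Proof. exact: asboolP. Qed.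

Lemma adic_null_zmod : zmod_closed adic_null.
Proof.
split=> [|u v /adic_nullP nu /adic_nullP nv]; apply/adic_nullP => n.
  by exists 0%N => i _; apply: ideal_exp0.
have [N1 h1] := nu n; have [N2 h2] := nv n.
exists (maxn N1 N2) => i; rewrite geq_max => /andP[i1 i2].
change (ideal_exp A n (u i - v i)).
by apply: ideal_expB; [apply: h1 | apply: h2].
Qed.

HB.instance Definition _ :=
  GRing.isZmodClosed.Build cauchySeq adic_null adic_null_zmod.

Lemma adic_nullM (u v : cauchySeq) : v \in adic_null -> u * v \in adic_null.
Proof.
move=> /adic_nullP nv; apply/adic_nullP => n.
by have [N h] := nv n; exists N => i Ni; apply: ideal_expM; apply: h.
Qed.

End CauchySequences.

(* The completion of R in the A-adic topology: Cauchy sequences modulo null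
   sequences.  MathComp gives {quot _} its ring structure only for a proper
   ideal of a nontrivial ring; for arbitrary A the quotient may be the zero
   ring, so only the additive structure is reused and the product is defined
   below. *)
Definition adic_completion (R : comNzRingType) (A : set R) : Type :=
  Quotient.quot (@adic_null R A).

Section CompletionRing.
Variables (R : comNzRingType) (A : set R).
Local Notation C := (adic_completion A).

HB.instance Definition _ := GRing.Zmodule.on C.

Definition cauchy_class : cauchySeq A -> C := \pi_(Quotient.quot (@adic_null R A))%qT.

Definition cauchy_repr : C -> cauchySeq A := repr.

Lemma cauchy_reprK : cancel cauchy_repr cauchy_class.
Proof. exact: reprK. Qed.

Lemma cauchy_class_eqP (u v : cauchySeq A) :
  reflect (cauchy_class u = cauchy_class v) (u - v \in @adic_null R A).
Proof. by rewrite Quotient.idealrBE; apply: eqP. Qed.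

Lemma cauchy_classD : {morph cauchy_class : u v / u + v}.
Proof. exact: Quotient.pi_add. Qed.

Definition completion_one : C := cauchy_class 1.

Definition completion_mul (x y : C) : C :=
  cauchy_class (cauchy_repr x * cauchy_repr y).

Lemma cauchy_class_mul (u v : cauchySeq A) :
  cauchy_class (u * v) = completion_mul (cauchy_class u) (cauchy_class v).
Proof.
apply/cauchy_class_eqP.
set u' := cauchy_repr _; set v' := cauchy_repr _.
have hu : u - u' \in @adic_null R A by apply/cauchy_class_eqP; rewrite cauchy_reprK.
have hv : v - v' \in @adic_null R A by apply/cauchy_class_eqP; rewrite cauchy_reprK.
have -> : u * v - u' * v' = v * (u - u') + u' * (v - v').
  by rewrite !mulrBr [v * u]mulrC [v * u']mulrC addrA subrK.
by apply: rpredD; apply: adic_nullM.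
Qed.

Lemma completion_mulA : associative completion_mul.
Proof.
move=> x y z; rewrite -[x]cauchy_reprK -[y]cauchy_reprK -[z]cauchy_reprK.
by rewrite -!cauchy_class_mul mulrA.
Qed.

Lemma completion_mulC : commutative completion_mul.
Proof. by move=> x y; rewrite /completion_mul mulrC. Qed.

Lemma completion_mul1 : left_id completion_one completion_mul.
Proof. by move=> x; rewrite -[x]cauchy_reprK -cauchy_class_mul mul1r. Qed.

Lemma completion_mulD : left_distributive completion_mul +%R.
Proof.
move=> x y z; rewrite -[x]cauchy_reprK -[y]cauchy_reprK -[z]cauchy_reprK.
by rewrite -cauchy_classD -!cauchy_class_mul -cauchy_classD mulrDl.
Qed.

HB.instance Definition _ := GRing.Zmodule_isComPzRing.Build C
  completion_mulA completion_mulC completion_mul1 completion_mulD.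

End CompletionRing.

Definition analytically_ramified (R : comNzRingType) :=
  exists2 M : set R, maximal_ideal M &
    exists2 x : adic_completion M, x <> 0 & exists n, x ^+ n = 0.

Notation "x %:F" := (FracField.tofrac x) : ring_scope.

Definition discrete_valuation (F : fieldType) (v : F -> int) :=
  [/\ forall x y, x != 0 -> y != 0 -> v (x * y) = v x + v y,
      forall x y, x != 0 -> y != 0 -> x + y != 0 ->
        (Num.min (v x) (v y) <= v (x + y))%R &
      forall n, exists2 x, x != 0 & v x = n].

(* The value of v at 0 is irrelevant (mathematically it is infinite). *)
Definition is_dvr (V : idomainType) :=
  exists2 v : {fraction V} -> int, discrete_valuation v &
    range (fun a : V => a%:F) = [set x | x = 0 \/ (0 <= v x)%R].

(* V is identified with the normalization of R through an injective ring
   morphism, so V is not required to be literally a subset of {fraction R}. *)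
Definition is_normalization (V R : idomainType) :=
  exists2 f : {rmorphism V -> {fraction R}}, injective f &
    range f = [set x | integralOver (fun a : R => a%:F) x].

Definition is_subfield (F : fieldType) (Q : set F) := divring_closed (mem Q).

Definition subfield_span (F : fieldType) (A : set F) : set F :=
  smallest (@is_subfield F) A.

(* Main.v *)
Require Import Defs.
From HB Require Import structures.
From mathcomp Require Import all_boot all_order all_algebra.
From mathcomp Require Import boolp classical_sets functions.
From mathcomp Require Import zify ring.

Set Implicit Arguments.
Unset Strict Implicit.
Unset Printing Implicit Defensive.

Import Order.TTheory GRing.Theory Num.Theory.
Local Open Scope ring_scope.
Local Open Scope classical_set_scope.

(** Write F for the fraction field of V and v for its valuation. Replacing Q by
    the subfield generated by Q and the p-th powers, condition (2) asks for a
    proper subfield K of F which contains all p-th powers and is dense for the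
    topology of v.

    From (2) to (1). Enlarge K, by Zorn's lemma, to a subfield L maximal among
    those avoiding a given y outside K. Then F = L(y) is purely inseparable of
    degree p over L, and d/dy is a derivation D of F that kills K
    ([exists_derivation]). Let R be the ring of the x in V with D x in V. It
    contains the p-th powers of V, so V is its integral closure. Since D is
    linear over the dense field Q, an element of R can be found with x and D x
    prescribed up to any power s^n of a uniformizer s in Q; moreover s^n R
    consists of the x for which both x and D x are divisible by s^n. Hence
    R/s^n R is (V/s^n V)[e] with e^2 = 0, through x |-> x + (D x) e. The ideals
    of such a ring need at most two generators, so R is Noetherian
    ([twisted_noetherian]), and a sequence converging to e is nilpotent and
    nonzero in the completion ([twisted_ramified]).

    From (1) to (2). Let A be the image of R in F and s a nonzero nonunit of A.
    The length l of A/sA is finite, and S/sS has length at most l for every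
    overring S of A inside V with a common denominator s^t
    ([length_le_overmodule]). This single bound has three uses. It yields such
    an S with V = S + sV ([exists_dense_overring]). It forces w^l into s S[w]
    for every w of positive valuation ([pow_in_ideal]), so that S[w] is generated
    over S by w^i for i < l. And from this it follows that x^q lies in S for all x
    in V, for one fixed power q of p ([frobenius_power_mem]): modulo nilpotents,
    the completion of S is that of V, and q bounds the order of nilpotency.

    Let T be the ring generated by S and the p-th powers of V. If T = V, then
    iterating Frobenius shows that V is generated by S and its q-th powers, so
    V = S has a common denominator over A; the M-adic topology of R is then the
    one of v and the completion has no nilpotents
    ([analytically_ramified_unbounded]). Otherwise take, by Zorn's lemma, a
    subfield K that contains the p-th powers of F and is maximal among those
    with K /\ V inside T. It is proper, and it is dense: were K to miss a
    uniformizer or a residue class of S, adjoining it would keep the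
    intersection with V inside T, because a polynomial of degree less than p in
    the new element has the smallest valuation of its terms
    ([exists_dense_subfield]). *)

(** * Subrings and subfields as sets, and polynomials over them *)

(** Zorn's lemma for inclusion above [A0], which bounds the empty chain. *)
Lemma Zorn_above (T : Type) (P : set (set T)) (A0 : set T) : P A0 ->
    (forall C : set (set T), C `<=` P -> C !=set0 -> total_on C subset ->
       P (\bigcup_(X in C) X)) ->
  exists A, [/\ P A, A0 `<=` A & forall B, P B -> A `<=` B -> B = A].
Proof.
move=> PA0 Pcup.
pose Q : set (set T) := [set A | P (A0 `|` A)].
have [|A [QA Amax]] := @Zorn_bigcup T Q.
  move=> C CQ Ctot; rewrite /Q /=.
  have [->|/eqP/eqP/set0P[X CX]] := eqVneq C set0;
    first by rewrite bigcup_set0 setU0.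
  rewrite (_ : A0 `|` _ = \bigcup_(X in [set A0 `|` X | X in C]) X).
    apply: Pcup.
    - by move=> _ [Y CY <-]; apply: CQ.
    - by exists (A0 `|` X), X.
    move=> _ _ [Y CY <-] [Z CZ <-].
    by have [YZ|ZY] := Ctot _ _ CY CZ; [left|right]; apply: setUS.
  apply/seteqP; split=> x.
    move=> [A0x|[Y CY Yx]]; first by exists (A0 `|` X); [exists X | left].
    by exists (A0 `|` Y); [exists Y | right].
  by move=> [_ [Y CY <-]] [A0x|Yx]; [left | right; exists Y].
exists (A0 `|` A); split=> // B PB AB.
apply/seteqP; split=> // x Bx; apply: contrapT => nx.
have: A `<` B.
  split; first by move=> z Az; apply: AB; right.
  by move=> /(_ x) AA; apply: nx; right; apply: AA.
move=> /Amax; apply; rewrite /Q /=.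
by rewrite (_ : _ `|` B = B) //; apply/setUidPr => z A0z; apply: AB; left.
Qed.

Section Subrings.
Variable F : fieldType.
Implicit Types (S K : set F) (x y z : F) (q : {poly F}).

Definition subring S :=
  [/\ S 1, forall x y, S x -> S y -> S (x - y) &
      forall x y, S x -> S y -> S (x * y)].

Definition subfield S := subring S /\ forall x, S x -> S x^-1.

Lemma is_subfieldP S : is_subfield S <-> subfield S.
Proof.
split=> [[S1 SB SD]|[[S1 SB SM] SV]].
  have {}S1 : S 1 by exact: set_mem.
  have {}SB x y : S x -> S y -> S (x - y).
    by move=> Sx Sy; apply: set_mem; apply: SB; apply: mem_set.
  have {}SD x y : S x -> S y -> S (x / y).
    by move=> Sx Sy; apply: set_mem; apply: SD; apply: mem_set.
  have SV x : S x -> S x^-1 by move=> Sx; rewrite -[_^-1]mul1r; apply: SD.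
  by split=> //; split=> // x y Sx Sy; rewrite -[y]invrK; apply: SD => //;
    apply: SV.
split; first exact: mem_set.
  by move=> x y /set_mem Sx /set_mem Sy; apply: mem_set; apply: SB.
by move=> x y /set_mem Sx /set_mem Sy; apply: mem_set; apply: SM => //; apply: SV.
Qed.

Section Closure.
Variable S : set F.
Hypothesis hS : subring S.

Lemma subring1 : S 1. Proof. by case: hS. Qed.
Lemma subringB x y : S x -> S y -> S (x - y). Proof. by case: hS => _ h _;
  apply: h. Qed.
Lemma subringM x y : S x -> S y -> S (x * y). Proof. by case: hS => _ _ h;
  apply: h. Qed.
Lemma subring0 : S 0. Proof. by rewrite -(subrr 1);
  apply: subringB subring1 subring1. Qed.
Lemma subringN x : S x -> S (- x).
Proof. by move=> Sx; rewrite -sub0r; apply: subringB => //; apply: subring0. Qed.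
Lemma subringD x y : S x -> S y -> S (x + y).
Proof. by move=> Sx Sy; rewrite -[y]opprK; apply: subringB => //;
  apply: subringN. Qed.
Lemma subringX x n : S x -> S (x ^+ n).
Proof.
by move=> Sx; elim: n => [|n IH]; rewrite ?exprS; [apply: subring1|apply: subringM].
Qed.
Lemma subring_sum (I : Type) (r : seq I) (P : pred I) (f : I -> F) :
  (forall i, P i -> S (f i)) -> S (\sum_(i <- r | P i) f i).
Proof.
by move=> h; elim/big_ind: _ => //; [exact: subring0 | exact: subringD].
Qed.
Lemma subringMn x n : S x -> S (x *+ n).
Proof.
move=> Sx; elim: n => [|n IH]; first by rewrite mulr0n; apply: subring0.
by rewrite mulrS; apply: subringD.
Qed.

End Closure.

Lemma subfieldB S : subfield S -> subring S. Proof. by case. Qed.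
Lemma subfieldV S x : subfield S -> S x -> S x^-1. Proof. by case=> _; apply. Qed.

Lemma subfield_bigcup (C : set (set F)) : C !=set0 -> total_on C subset ->
  (forall K, C K -> subfield K) -> subfield (\bigcup_(K in C) K).
Proof.
move=> [K0 CK0] Ctot CS.
have two x y : (\bigcup_(K in C) K) x -> (\bigcup_(K in C) K) y ->
    exists K, [/\ C K, K x & K y].
  move=> [K CK Kx] [K' CK' Ky].
  by have [KK'|KK'] := Ctot _ _ CK CK'; [exists K'|exists K]; split=> //;
    apply: KK'.
split; [split|].
- by exists K0 => //; case: (CS _ CK0) => -[].
- move=> x y Ux Uy; have [K [CK Kx Ky]] := two _ _ Ux Uy; exists K => //.
  by apply: subringB => //; case: (CS _ CK).
- move=> x y Ux Uy; have [K [CK Kx Ky]] := two _ _ Ux Uy; exists K => //.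
  by apply: subringM => //; case: (CS _ CK).
by move=> x [K CK Kx]; exists K => //; apply: subfieldV => //; apply: CS.
Qed.

Definition coefs S q := forall i, S q`_i.

Section CoefsClosure.
Variable S : set F.
Hypothesis hS : subring S.

Lemma coefsC c : S c -> coefs S c%:P.
Proof. by move=> Sc i; rewrite coefC; case: ifP => // _; apply: subring0. Qed.
Lemma coefsX : coefs S 'X.
Proof. by move=> i; rewrite coefX; case: eqP => _ /=;
  [apply: subring1|apply: subring0]. Qed.
Lemma coefsB q r : coefs S q -> coefs S r -> coefs S (q - r).
Proof. by move=> Sq Sr i; rewrite coefB; apply: subringB. Qed.
Lemma coefsD q r : coefs S q -> coefs S r -> coefs S (q + r).
Proof. by move=> Sq Sr i; rewrite coefD; apply: subringD. Qed.
Lemma coefsM q r : coefs S q -> coefs S r -> coefs S (q * r).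
Proof.
by move=> Sq Sr i; rewrite coefM; apply: subring_sum => // j _; apply: subringM.
Qed.
Lemma coefsX_exp q n : coefs S q -> coefs S (q ^+ n).
Proof.
move=> Sq; elim: n => [|n IH]; rewrite ?exprS; last exact: coefsM.
by rewrite expr0 -polyC1; apply: coefsC; apply: subring1.
Qed.
Lemma coefsXn n : coefs S 'X^n. Proof. by apply: coefsX_exp; apply: coefsX. Qed.
Lemma coefsZ c q : S c -> coefs S q -> coefs S (c *: q).
Proof. by move=> Sc Sq i; rewrite coefZ; apply: subringM. Qed.

Lemma coefs_horner q x : coefs S q -> S x -> S q.[x].
Proof.
move=> Sq Sx; rewrite horner_coef; apply: subring_sum => // i _.
by apply: subringM => //; apply: subringX.
Qed.

(** Dividing by a monic polynomial involves no division of coefficients, so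
    quotient and remainder keep their coefficients in the subring. *)
Lemma coefs_divmod f q : coefs S f -> f \is monic -> coefs S q ->
  exists h r, [/\ coefs S h, coefs S r, q = h * f + r & (size r < size f)%N].
Proof.
move=> Sf fmon; have szf : (0 < size f)%N by rewrite size_poly_gt0 monic_neq0.
have [n] := ubnP (size q); elim: n q => // n IH q szq Sq.
have [lt|le] := ltnP (size q) (size f).
  exists 0, q; rewrite mul0r add0r; split=> //.
  by rewrite -polyC0; apply: coefsC; apply: subring0.
pose c := lead_coef q; pose m := (size q - size f)%N.
pose q' := q - c *: 'X^m * f.
have Sc : coefs S (c *: 'X^m) by apply: coefsZ; [apply: Sq|apply: coefsXn].
have Sq' : coefs S q' by apply: coefsB => //; apply: coefsM.
have q0 : q != 0 by rewrite -size_poly_gt0 (leq_trans szf).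
have szm : size (c *: 'X^m * f) = size q.
  rewrite -scalerAl size_scale ?lead_coef_eq0// size_Mmonic//.
    by rewrite size_polyXn addSn /= subnK.
  by rewrite -size_poly_gt0 size_polyXn.
have {}/IH IH : (size q' < n)%N.
  apply: leq_trans (_ : size q <= n)%N => //.
  rewrite -[size q]prednK ?size_poly_gt0// ltnS; apply/leq_sizeP => j.
  rewrite leq_eqVlt => /predU1P[<-|lt].
    rewrite coefB -lead_coefE -[X in _ - _`_X](_ : (size (c *: 'X^m * f)).-1 = _).
      by rewrite -lead_coefE lead_coefM lead_coefZ lead_coefXn mulr1 (monicP
        fmon) mulr1 subrr.
    by rewrite szm.
  by rewrite prednK ?size_poly_gt0// in lt; rewrite coefB !nth_default ?subrr// szm.
have [h [r [Sh Sr e lt]]] := IH Sq'.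
exists (h + c *: 'X^m), r; split=> //; first exact: coefsD.
by rewrite mulrDl addrAC -e /q' subrK.
Qed.

End CoefsClosure.

Lemma coefs_sub S S' q : S `<=` S' -> coefs S q -> coefs S' q.
Proof. by move=> SS' Sq i; apply: SS'. Qed.

Definition adjoin S x : set F := [set y | exists2 q, coefs S q & y = q.[x]].

Lemma adjoin_subring S x : subring S -> subring (adjoin S x).
Proof.
move=> hS; split.
- by exists 1%:P; [exact: (coefsC hS (subring1 hS))|rewrite hornerC].
- by move=> _ _ [q Sq ->] [r Sr ->]; exists (q - r); rewrite ?hornerE//;
    apply: coefsB.
by move=> _ _ [q Sq ->] [r Sr ->]; exists (q * r); rewrite ?hornerE//;
  apply: coefsM.
Qed.

Lemma adjoin_sub S x : subring S -> S `<=` adjoin S x.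
Proof. by move=> hS y Sy; exists y%:P; [apply: coefsC|rewrite hornerC]. Qed.

Lemma adjoin_gen S x : subring S -> adjoin S x x.
Proof. by move=> hS; exists 'X; [apply: coefsX|rewrite hornerX]. Qed.

Lemma adjoin_min S S' x : subring S' -> S `<=` S' -> S' x -> adjoin S x `<=` S'.
Proof. by move=> hS' SS' S'x _ [q Sq ->]; apply: coefs_horner => //;
  exact: (coefs_sub SS' Sq). Qed.

End Subrings.

(** * Purely inseparable extensions of exponent one *)

Section Inseparable.
Variables (F : fieldType) (p : nat).
Hypothesis hp : p \in [pchar F].
Variable L : set F.
Hypotheses (hL : subfield L) (Lp : forall x, L (x ^+ p)).

Let Lr : subring L := subfieldB hL.

Let p_gt0 : (0 < p)%N. Proof. exact/prime_gt0/(pcharf_prime hp). Qed.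

Lemma natr_pchar_neq0 n : (0 < n < p)%N -> n%:R != 0 :> F.
Proof.
move=> /andP[n0 np]; rewrite -(dvdn_pcharf hp); apply/negP => /dvdn_leq.
by move=> /(_ n0); rewrite leqNgt np.
Qed.

Lemma XsubC_pchar (z : F) : ('X - z%:P) ^+ p = 'X^p - (z ^+ p)%:P.
Proof.
have pp : p \in [pchar {poly F}] by rewrite pchar_poly.
rewrite -(pFrobenius_autE pp) pFrobenius_autB_comm; last exact: mulrC.
by rewrite !pFrobenius_autE rmorphXn.
Qed.

(** The minimal polynomial of [z] over [L] divides [(X - z)^p], hence is [(X -
    z)^k]; its coefficient of degree [k - 1] is [- k z], and [k] is invertible
    when [0 < k < p]. *)
Lemma insep_root f z : f != 0 -> coefs L f -> (size f <= p)%N -> root f z -> L z.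
Proof.
pose P n := `[< exists f, [/\ f != 0, coefs L f, root f z & size f = n] >].
move=> f0 Lf fp fz; have /ex_minnP[n /asboolP[g [g0 Lg gz sg]] nmin]
  : exists n, P n.
  by exists (size f); apply/asboolP; exists f.
have np : (n <= p)%N by apply: leq_trans fp; apply: nmin; apply/asboolP; exists f.
have lg0 : lead_coef g != 0 by rewrite lead_coef_eq0.
have [h [hm Lh sh hz]] : exists h, [/\
  h \is monic, coefs L h, size h = n & root h z].
  exists ((lead_coef g)^-1 *: g); split.
  - by rewrite monicE lead_coefZ mulVf.
  - by apply: coefsZ => //; apply: subfieldV hL _; apply: Lg.
  - by rewrite size_scale ?invr_eq0.
  by rewrite rootE hornerZ (rootP gz) mulr0.
have Lpp : coefs L ('X^p - (z ^+ p)%:P) by apply: coefsB => //;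
  [apply: coefsXn|apply: coefsC].
have [d [r [Ld Lr' e sr]]] := coefs_divmod Lr Lh hm Lpp.
have r0 : r = 0.
  apply/eqP/negPn/negP => r0; move: sr; rewrite sh ltnNge => /negP; apply.
  apply: nmin; apply/asboolP; exists r; split=> //.
  have -> : r = 'X^p - (z ^+ p)%:P - d * h by rewrite e addrC addKr.
  by rewrite rootE !hornerE (rootP hz) mulr0 subrr subr0.
have /dvdp_exp_XsubCP[k kp] : h %| ('X - z%:P) ^+ p.
  by rewrite XsubC_pchar e r0 addr0 dvdp_mull.
rewrite eqp_monic ?rpredX ?monicXsubC// => /eqP hE.
have nk : n = k.+1 by rewrite -sh hE size_exp_XsubC.
have k0 : (0 < k)%N.
  rewrite lt0n; apply/negP => /eqP k0.
  by move: hz; rewrite hE k0 expr0 rootE hornerC oner_eq0.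
have knz : k%:R != 0 :> F by apply: natr_pchar_neq0; rewrite k0 -nk.
have : L h`_k.-1 by [].
have -> : h`_k.-1 = - (z *+ k).
  have := @coefPn_prod_XsubC F (nseq k z); rewrite size_nseq -lt0n => /(_ k0).
  by rewrite !big_nseq iter_mulr_1 -hE iter_addr_0.
move=> /(subringN Lr); rewrite opprK => zk.
rewrite -[z](mulfK knz) mulr_natr; apply: subringM => //; apply: subfieldV hL _.
by apply: subringMn => //; apply: subring1.
Qed.

End Inseparable.

Section PurelyInseparable.
Variables (F : fieldType) (p : nat).
Hypothesis hp : p \in [pchar F].

Lemma pchar_gt0 : (0 < p)%N. Proof. exact/prime_gt0/(pcharf_prime hp). Qed.

Section Adjoin.
Variable L : set F.
Hypotheses (hL : subfield L) (Lp : forall x, L (x ^+ p)).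

Let Lr : subring L := subfieldB hL.

Lemma coefs_divXp z f : coefs L f ->
  exists h r, [/\ coefs L h, coefs L r, f = h * ('X^p - (z ^+ p)%:P) + r &
                  (size r <= p)%N].
Proof.
move=> Lf.
have Lpp : coefs L ('X^p - (z ^+ p)%:P).
  by apply: coefsB => //; [apply: coefsXn|apply: coefsC].
have pm : 'X^p - (z ^+ p)%:P \is monic by apply: monicXnsubC; apply: pchar_gt0.
have [h [r [Lh Lr' e sr]]] := coefs_divmod Lr Lpp pm Lf.
by exists h, r; split=> //; move: sr; rewrite size_XnsubC ?pchar_gt0.
Qed.

(** Since [z^p] is in [L], powers of [z] beyond the [p]-th can be reduced. *)
Lemma adjoin_small z x : adjoin L z x ->
  exists f, [/\ coefs L f, (size f <= p)%N & x = f.[z]].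
Proof.
move=> [f Lf ->]; have [h [r [_ Lr' -> sr]]] := coefs_divXp z Lf.
by exists r; split=> //; rewrite !hornerE subrr mulr0 add0r.
Qed.

(** Inverses exist because [x^-1 = x^(p-1) / x^p], where [x^p] is already in
    [L]. *)
Lemma adjoin_subfield z : subfield (adjoin L z).
Proof.
have hA : subring (adjoin L z) by apply: adjoin_subring.
split=> // x Ax; have [->|x0] := eqVneq x 0; first by rewrite invr0;
  apply: subring0.
have -> : x^-1 = x ^+ p.-1 * (x ^+ p)^-1.
  by rewrite -{2}(prednK pchar_gt0) exprS invfM mulrCA mulfV ?mulr1// expf_eq0
    (negPf x0) andbF.
apply: subringM => //; first exact: subringX.
by apply: adjoin_sub => //; apply: subfieldV hL _.
Qed.

End Adjoin.

(** Take [L] maximal among the subfields containing [K] and avoiding [y]. Every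
    [z] is in [L(y)]: if not, then [y] is in [L(z)], say [y = f(z)] with [f] of
    degree less than [p], and [f - y] is a polynomial of degree less than [p]
    over [L(y)] vanishing at [z], which puts [z] in [L(y)] by [insep_root]. The
    derivation is [f(y) |-> f'(y)]; it is well defined because the polynomials
    vanishing at [y] are the multiples of [X^p - y^p], whose derivative
    vanishes. *)
Lemma exists_derivation (K : set F) (y : F) :
    subfield K -> (forall x, K (x ^+ p)) -> ~ K y ->
  exists D : F -> F, [/\ {morph D : a b / a + b},
    forall a b, D (a * b) = D a * b + a * D b,
    forall k, K k -> D k = 0 & D y = 1].
Proof.
move=> hK Kp Ky.
pose P := [set L | [/\ subfield L, K `<=` L & ~ L y]].
have [L [[hL KL Ly] _ Lmax]] : exists L, [/\
  P L, K `<=` L & forall B, P B -> L `<=` B -> B = L].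
  apply: Zorn_above => [|C]; first by split.
  move=> CP [L0 CL0] Ctot; split.
  - by apply: subfield_bigcup => //; [exists L0|move=> L /CP[]].
  - by move=> k Kk; exists L0 => //; have [_ KL0 _] := CP _ CL0; apply: KL0.
  by move=> [L /CP[]].
have Lp x : L (x ^+ p) by apply: KL.
have Lr := subfieldB hL.
have gen z : adjoin L y z.
  apply: contrapT => Nz; have hA := adjoin_subfield hL Lp.
  have : adjoin L z y.
    apply: contrapT => Ny; apply: Nz.
    (* [L(z)] avoids [y] too, so the maximality of [L] applies *)
    have LzL : adjoin L z = L.
      apply: Lmax; last exact: adjoin_sub.
      by split=> // k Kk; apply: adjoin_sub => //; apply: KL.
    by apply: adjoin_sub => //; rewrite -LzL; apply: adjoin_gen.
  move=> /(adjoin_small hL Lp)[f [Lf sf yf]]; apply: Nz.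
  apply: (insep_root hp (hA y) _ (f := f - y%:P)).
  - by move=> x; apply: adjoin_sub.
  - rewrite subr_eq0; apply/eqP => fy; apply: Ly.
    by have := Lf 0%N; rewrite fy coefC eqxx.
  - apply: coefsB; first exact: subfieldB.
      by apply: coefs_sub Lf; apply: adjoin_sub.
    by apply: coefsC; [apply: subfieldB | apply: adjoin_gen].
  - rewrite (leq_trans (size_polyD _ _))// size_polyN geq_max sf size_polyC.
    by rewrite (leq_trans (leq_b1 _))// pchar_gt0.
  by rewrite rootE !hornerE -yf subrr.
have wd f : coefs L f -> f.[y] = 0 -> f^`().[y] = 0.
  move=> Lf; have [h [r [_ Lr' -> sr]]] := coefs_divXp hL Lp y Lf.
  rewrite !hornerE subrr mulr0 add0r => ry.
  have -> : r = 0.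
    apply/eqP/negPn/negP => r0; apply: Ly.
    by apply: (insep_root hp hL Lp r0) => //; rewrite rootE ry.
  have pX : p \in [pchar {poly F}] by rewrite pchar_poly.
  rewrite derivD derivM derivB derivXn derivC deriv0 (mulrn_pchar pX) subr0 addr0.
  by rewrite !hornerE subrr !mulr0 ?addr0.
have /choice[g gP] : forall z, exists f, coefs L f /\ z = f.[y].
  by move=> z; have [f Lf zf] := gen z; exists f.
pose D z := (g z)^`().[y].
have DE f : coefs L f -> D f.[y] = f^`().[y].
  move=> Lf; have [Lg e] := gP f.[y]; apply/eqP; rewrite -subr_eq0.
  rewrite -hornerN -hornerD -derivN -derivD; apply/eqP/wd; first exact: coefsB.
  by rewrite !hornerE -e subrr.
exists D; split.
- move=> a b; have [La ea] := gP a; have [Lb eb] := gP b.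
  by rewrite {1}ea {1}eb -hornerD DE ?derivD ?hornerD//; apply: coefsD.
- move=> a b; have [La ea] := gP a; have [Lb eb] := gP b.
  rewrite {1}ea {1}eb -hornerM DE; last exact: coefsM.
  by rewrite derivM !hornerE -ea -eb.
- by move=> k /KL Lk; rewrite -[k](hornerC _ y) DE ?derivC ?horner0//;
    apply: coefsC.
by rewrite -{1}[y]hornerX DE ?derivX ?hornerC//; apply: coefsX.
Qed.

End PurelyInseparable.

(** * Discrete valuations *)

Section Valuation.
Variables (F : fieldType) (v : F -> int).
Hypothesis hv : discrete_valuation v.
Implicit Types (x y z : F) (n m : int).

(** The fractional ideal of elements of valuation at least [n]; the explicit [x
    = 0] makes the junk value of [v] at [0] irrelevant. [vge 0] is the valuation
    ring and [vge 1] its maximal ideal. *)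
Definition vge n : set F := [set x | x = 0 \/ n <= v x].

Lemma valuationM x y : x != 0 -> y != 0 -> v (x * y) = v x + v y.
Proof. by case: hv => h _ _; apply: h. Qed.

Lemma valuation1 : v 1 = 0.
Proof.
have e : v 1 = v 1 + v 1 by rewrite -valuationM ?oner_neq0// mulr1.
by move: e; lia.
Qed.

Lemma valuationX x k : x != 0 -> v (x ^+ k) = v x *+ k.
Proof.
move=> x0; elim: k => [|k IH]; first by rewrite valuation1 mulr0n.
by rewrite exprS valuationM ?expf_neq0// IH mulrS.
Qed.

Lemma valuationV x : x != 0 -> v x^-1 = - v x.
Proof.
move=> x0; apply/eqP; rewrite -addr_eq0 addrC.
by rewrite -valuationM ?invr_eq0// mulfV// valuation1.
Qed.

Lemma valuationN x : v (- x) = v x.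
Proof.
have [->|x0] := eqVneq x 0; first by rewrite oppr0.
have N1 : - 1 != 0 :> F by rewrite oppr_eq0 oner_neq0.
have e : v (- 1) + v (- 1) = 0 by rewrite -valuationM// mulrNN mulr1 valuation1.
have {}e : v (- 1) = 0 by move: e; lia.
by rewrite -mulN1r valuationM// e add0r.
Qed.

Lemma vgeE n x : x != 0 -> vge n x -> n <= v x.
Proof. by move=> x0 [xE|//]; rewrite xE eqxx in x0. Qed.

Lemma vgeW n m x : m <= n -> vge n x -> vge m x.
Proof. by move=> mn [->|nx]; [left | right; apply: le_trans nx]. Qed.

Lemma vgeN n x : vge n x -> vge n (- x).
Proof. by move=> [->|nx]; [left; rewrite oppr0|right; rewrite valuationN]. Qed.

Lemma vgeD n x y : vge n x -> vge n y -> vge n (x + y).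
Proof.
have [->|x0] := eqVneq x 0; first by rewrite add0r.
have [->|y0] := eqVneq y 0; first by rewrite addr0.
have [->|xy0] := eqVneq (x + y) 0; first by move=> *; left.
move=> /(vgeE x0) nx /(vgeE y0) ny; right.
by case: hv => _ h _; apply: le_trans (h _ _ x0 y0 xy0); rewrite le_min nx.
Qed.

Lemma vgeB n x y : vge n x -> vge n y -> vge n (x - y).
Proof. by move=> nx ny; apply: vgeD => //; apply: vgeN. Qed.

Lemma vgeM n m x y : vge n x -> vge m y -> vge (n + m) (x * y).
Proof.
have [->|x0] := eqVneq x 0; first by rewrite mul0r; left.
have [->|y0] := eqVneq y 0; first by rewrite mulr0; left.
by move=> /(vgeE x0) nx /(vgeE y0) ny; right; rewrite valuationM//; lia.
Qed.

Lemma vgeX n x k : vge n x -> vge (n *+ k) (x ^+ k).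
Proof.
move=> nx; elim: k => [|k IH]; first by right; rewrite expr0 valuation1 mulr0n.
by rewrite exprS mulrS; apply: vgeM.
Qed.

Lemma vge_val x : vge (v x) x. Proof. by right. Qed.

Lemma vge1 : vge 0 1. Proof. by right; rewrite valuation1. Qed.

Lemma vgeV x : x != 0 -> vge (- v x) x^-1.
Proof. by move=> x0; right; rewrite valuationV. Qed.

Lemma vge_div n x y : y != 0 -> vge n x -> vge (n - v y) (x / y).
Proof. by move=> y0 nx; apply: vgeM => //; apply: vgeV. Qed.

Lemma vge_subring : subring (vge 0).
Proof.
split; [exact: vge1 | by move=> x y; apply: vgeB|].
by move=> x y; rewrite -{3}[0]addr0; apply: vgeM.
Qed.

Lemma vgeMl n x y : vge 0 x -> vge n y -> vge n (x * y).
Proof. by rewrite -{2}[n]add0r; apply: vgeM. Qed.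

Lemma vgeMr n x y : vge n x -> vge 0 y -> vge n (x * y).
Proof. by rewrite -{2}[n]addr0; apply: vgeM. Qed.

Lemma vge_sum n (I : Type) (r : seq I) (P : pred I) (f : I -> F) :
  (forall i, P i -> vge n (f i)) -> vge n (\sum_(i <- r | P i) f i).
Proof.
by move=> h; elim/big_ind: _ => //; [left | move=> *; apply: vgeD].
Qed.

Lemma vge_root x k : (0 < k)%N -> vge 0 (x ^+ k) -> vge 0 x.
Proof.
move=> k0; have [->|x0] := eqVneq x 0; first by left.
move=> /(vgeE (expf_neq0 _ x0)); rewrite valuationX// => h; right.
by rewrite pmulrn_lge0 in h.
Qed.

(** The ultrametric inequality is an equality when the minimum is reached once. *)
Lemma valuation_dom x y : x != 0 -> vge (v x + 1) y -> x + y != 0 /\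
  v (x + y) = v x.
Proof.
move=> x0 hy; have xy0 : x + y != 0.
  apply/negP => /eqP e; have yx : y = - x by rewrite -[y]opprK; congr (- _);
    apply/eqP; rewrite eq_sym -addr_eq0 e.
  by move: hy; rewrite yx => /(vgeE _); rewrite oppr_eq0 valuationN => /(_ x0); lia.
split=> //; apply/eqP; rewrite eq_le; apply/andP; split; last first.
  apply: vgeE => //; apply: vgeD; first exact: vge_val.
  by apply: vgeW hy; lia.
rewrite leNgt; apply/negP => lt.
suff /(vgeE x0) : vge (v x + 1) x by lia.
rewrite -[X in vge _ X](addrK y); apply: vgeB => //.
by right; rewrite lezD1.
Qed.

Lemma exists_val n : exists2 x, x != 0 & v x = n.
Proof. by case: hv => _ _; apply. Qed.

Lemma vge_dvd n x y : y != 0 -> v y <= n -> vge n x -> vge 0 (x / y).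
Proof. by move=> y0 yn /(vge_div y0); apply: vgeW; lia. Qed.

Lemma vge_unit x : vge 0 x -> ~ vge 1 x -> x != 0 /\ v x = 0.
Proof.
move=> [->|x0] nx; first by case: nx; left.
have xn0 : x != 0 by apply/negP => /eqP e; apply: nx; left.
split=> //; apply/eqP; rewrite eq_le x0 andbT leNgt; apply/negP => lt.
by apply: nx; right; lia.
Qed.

(** In a monic equation, an element of negative valuation would make the leading
    term strictly dominate the others. *)
Lemma vge_integral x q : q \is monic -> coefs (vge 0) q -> root q x -> vge 0 x.
Proof.
move=> qm Oq qx; have [->|x0] := eqVneq x 0; first by left.
have [//|xn] := leP 0 (v x); first by right.
have [n sq] : exists n : nat, size q = n.+1.
  by exists (size q).-1; rewrite prednK// size_poly_gt0 monic_neq0.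
have : q.[x] = 0 by apply/eqP.
rewrite horner_coef sq big_ord_recr /=.
have -> : q`_n = 1 by rewrite -(monicP qm) lead_coefE sq.
rewrite mul1r addrC => e.
have := valuation_dom (expf_neq0 n x0) (_ : vge _ (\sum_(i < n) q`_i * x ^+ i)).
rewrite e eqxx => -[]//; apply: vge_sum => i _.
apply: vgeMl; first exact: Oq.
right; rewrite !valuationX//.
by rewrite lezD1 ltr_nMn2l.
Qed.

End Valuation.

(** * Lengths of modules inside a field *)

Section Length.
Variables (F : fieldType) (A : set F).
Hypothesis hA : subring A.
Implicit Types (M N J : set F) (C : nat -> set F) (b c x y : F).

Definition submod N := N 0 /\ forall a x y, A a -> N x -> N y -> N (a * x + y).

Definition scale c N : set F := [set c * x | x in N].
Definition sumset M N : set F := [set x + y | x in M & y in N].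

Lemma submod0 N : submod N -> N 0. Proof. by case. Qed.
Lemma submodD N x y : submod N -> N x -> N y -> N (x + y).
Proof. by move=> [_ h] Nx Ny; rewrite -[x]mul1r; apply: h => //;
  apply: subring1. Qed.
Lemma submodM N a x : submod N -> A a -> N x -> N (a * x).
Proof. by move=> [N0 h] Aa Nx; rewrite -[_ * _]addr0; apply: h. Qed.
Lemma submodB N x y : submod N -> N x -> N y -> N (x - y).
Proof.
move=> hN Nx Ny; rewrite addrC -mulN1r; case: hN => _; apply=> //.
by apply: subringN => //; apply: subring1.
Qed.

Lemma subring_submod N : subring N -> A `<=` N -> submod N.
Proof.
move=> hN AN; split=> [|a x y Aa Nx Ny]; first exact: subring0.
by apply: subringD => //; apply: subringM => //; apply: AN.
Qed.

Lemma ring_submod : submod A. Proof. exact: subring_submod. Qed.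

Lemma submod_cap M N : submod M -> submod N -> submod (M `&` N).
Proof.
by move=> [M0 hM] [N0 hN]; split=> // a x y Aa [Mx Nx] [My Ny]; split;
  [apply: hM|apply: hN].
Qed.

Lemma submod_sum M N : submod M -> submod N -> submod (sumset M N).
Proof.
move=> hM hN; split; first by exists 0; [apply: submod0|exists 0;
  [apply: submod0|rewrite addr0]].
move=> a _ _ Aa [x Mx [y Ny <-]] [x' Mx' [y' Ny' <-]].
exists (a * x + x'); first by case: hM => _; apply.
by exists (a * y + y'); [case: hN => _; apply | rewrite mulrDr addrACA].
Qed.

Lemma submod_scale c N : submod N -> submod (scale c N).
Proof.
move=> hN; split; first by exists 0; [apply: submod0|rewrite mulr0].
move=> a _ _ Aa [x Nx <-] [y Ny <-]; exists (a * x + y);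
  first by case: hN => _; apply.
by rewrite mulrDr mulrCA.
Qed.

Lemma submod_preim c N : submod N -> submod [set x | N (c * x)].
Proof.
move=> hN; split; first by rewrite /= mulr0; apply: submod0.
by move=> a x y Aa Nx Ny /=; rewrite mulrDr mulrCA; case: hN => _; apply.
Qed.

Lemma sumsetl M N : N 0 -> M `<=` sumset M N.
Proof. by move=> N0 x Mx; exists x => //; exists 0; rewrite ?addr0. Qed.
Lemma sumsetr M N : M 0 -> N `<=` sumset M N.
Proof. by move=> M0 x Nx; exists 0 => //; exists x; rewrite ?add0r. Qed.
Lemma sumset_min M N J : submod J -> M `<=` J -> N `<=` J -> sumset M N `<=` J.
Proof. by move=> hJ MJ NJ _ [x Mx [y Ny <-]]; apply: submodD => //;
  [apply: MJ|apply: NJ]. Qed.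
Lemma sumsetS M M' N : M `<=` M' -> sumset M N `<=` sumset M' N.
Proof. by move=> MM' _ [x Mx [y Ny <-]]; exists x; [apply: MM'|exists y]. Qed.

Lemma scaleS c M N : M `<=` N -> scale c M `<=` scale c N.
Proof. by move=> MN _ [x Mx <-]; exists x => //; apply: MN. Qed.

Lemma scaleK c N : c != 0 -> scale c^-1 (scale c N) = N.
Proof.
move=> c0; apply/seteqP; split=> [_ [_ [x Nx <-] <-]|x Nx]; first by rewrite mulKf.
by exists (c * x); [exists x|rewrite mulKf].
Qed.

Lemma scale_sub c N : submod N -> A c -> scale c N `<=` N.
Proof. by move=> hN Ac _ [x Nx <-]; apply: submodM. Qed.

Lemma scaleM b c N : scale b (scale c N) = scale (b * c) N.
Proof.
apply/seteqP; split=> [_ [_ [x Nx <-] <-]|_ [x Nx <-]].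
  by exists x => //; rewrite mulrA.
by exists (c * x); [exists x|rewrite mulrA].
Qed.

(** Chains are decreasing sequences that may stagnate, so that intersecting a
    chain with a module, or adding one to it, gives a chain again; only the
    strict steps are counted. *)
Definition jumps C m := (\sum_(i < m) `[< C i <> C i.+1 >])%N.

Definition chain M N C :=
  [/\ forall i, submod (C i), forall i, C i.+1 `<=` C i, C 0%N `<=` M &
      forall i, N `<=` C i].

(** [M/N] has length at most [n]. *)
Definition length_le n M N := forall C m, chain M N C -> (jumps C m <= n)%N.

Lemma chain_sub M N C i : chain M N C -> C i `<=` M.
Proof.
move=> [_ dec C0 _]; elim: i => // i IH.
by apply: (subset_trans (dec i)).
Qed.

Lemma length_leS n n' M M' N N' : (n <= n')%N -> M' `<=` M -> N `<=` N' ->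
  length_le n M N -> length_le n' M' N'.
Proof.
move=> nn' MM NN h C m [sC dC C0 CN]; apply: leq_trans nn'; apply: h.
by split=> //; [apply: subset_trans MM|move=> i; apply: subset_trans (CN i)].
Qed.

(** The modular law, in the form that makes a strict step of a chain survive
    either in the intersection with [J] or in the sum with [J]. *)
Lemma modular_eq M N J : submod M -> submod N -> M `<=` N -> N `&` J `<=` M ->
  N `<=` sumset M J -> N = M.
Proof.
move=> hM hN MN NJ NMJ; apply/seteqP; split=> // x Nx.
have [y My [z Jz yz]] := NMJ _ Nx.
rewrite -yz; apply: submodD => //; apply: NJ; split=> //.
by rewrite (_ : z = x - y); [apply: submodB => //;
  apply: MN | rewrite -yz addrC addKr].
Qed.

(** Subadditivity of length in [N <= J <= M]: split a chain into its trace on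
    [J] and its image modulo [J]. *)
Lemma length_le_trans n1 n2 M J N : submod M -> submod J -> J `<=` M -> N `<=` J ->
  length_le n1 M J -> length_le n2 J N -> length_le (n1 + n2) M N.
Proof.
move=> hM hJ JM NJ h1 h2 C m hC; have [sC dC C0 CN] := hC.
pose C1 i := sumset (C i) J; pose C2 i := C i `&` J.
have c1 : chain M J C1.
  split=> [i|i||i]; first exact: submod_sum.
  - exact: sumsetS.
  - exact: sumset_min.
  by apply: sumsetr; apply: submod0.
have c2 : chain J N C2.
  split=> [i|i|x []//|i x Nx]; first exact: submod_cap.
    by move=> x [Cx Jx]; split=> //; apply: dC.
  by split; [apply: CN|apply: NJ].
apply: leq_trans (leq_add (h1 _ m c1) (h2 _ m c2)).
rewrite /jumps -big_split leq_sum// => i _.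
case: asboolP => //= Cne; do 2 case: asboolP => //=.
move=> e2 e1; exfalso; move/contrapT in e2; move/contrapT in e1; apply: Cne.
apply: (@modular_eq _ _ J) => //.
  by rewrite -/(C2 i) e2 => x [].
by rewrite -/(C1 i.+1) -e1; apply: sumsetl; apply: submod0.
Qed.

Lemma length_le_scale n c M N : c != 0 -> length_le n M N ->
  length_le n (scale c M) (scale c N).
Proof.
move=> c0 h C m hC; have [sC dC C0 CN] := hC.
pose C' i : set F := [set x | C i (c * x)].
have c' : chain M N C'.
  split=> [i|i x /=|x /=|i x Nx /=]; first exact: submod_preim.
  - exact: dC.
  - by move=> /C0[y My /(mulfI c0) <-].
  by apply: CN; exists x.
apply: leq_trans (h _ m c'); rewrite leq_sum// => i _.
case: asboolP => //= Cne; case: asboolP => //= /contrapT e; exfalso; apply: Cne.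
have Ci j x : C j x = C' j (x / c) by rewrite /C' /= mulrC mulfVK.
by apply/funext => x; rewrite !Ci e.
Qed.

Lemma length_le_max n M N : submod M -> N `<=` M -> length_le n M N ->
  exists C m k, [/\ chain M N C, jumps C m = k & length_le k M N].
Proof.
move=> hM NM h.
pose P k := `[< exists C m, chain M N C /\ jumps C m = k >].
have P0 : exists k, P k.
  exists (jumps (fun _ => M) 0%N); apply/asboolP; exists (fun _ => M), 0%N.
  by split=> //; split=> // *; exact: subset_refl.
have Pn k : P k -> (k <= n)%N by move=> /asboolP[C [m [hC <-]]]; apply: h.
have [k /asboolP[C [m [hC jC]]] kmax] := ex_maxnP P0 Pn.
exists C, m, k; split=> // C' m' hC'; apply: kmax; apply/asboolP.
by exists C', m'.
Qed.

Lemma jumps_scale c C m : c != 0 -> jumps (fun i => scale c (C i)) m = jumps C m.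
Proof.
move=> c0; apply: eq_bigr => i _; congr nat_of_bool.
apply/asboolP/asboolP => ne e; apply: ne; first by rewrite e.
by rewrite -[C i](scaleK _ c0) e scaleK.
Qed.

(** Superadditivity of length: the second chain is appended to the first. *)
Lemma chain_cat M J J' N C C' m m' : J' `<=` J -> J' `<=` M -> N `<=` J ->
    chain M J C -> chain J' N C' ->
  exists2 E, chain M N E & (jumps C m + jumps C' m' <= jumps E (m + m'.+1))%N.
Proof.
move=> J'J J'M NJ hC hC'; have [sC dC C0 CN] := hC; have [sC' dC' C0' CN'] := hC'.
pose E i := if (i <= m)%N then C i else C' (i - m.+1)%N.
exists E.
  split=> [i|i||i]; rewrite /E.
  - by case: ifP.
  - have [lt|] := ltnP i m; first by rewrite ltnW.
    rewrite leq_eqVlt => /predU1P[<-|lt]; last by rewrite leqNgt lt/= subSn.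
    by rewrite leqnn subnn; apply: (subset_trans C0'); apply: (subset_trans J'J).
  - by [].
  by case: ifP => _; [apply: (subset_trans NJ)|].
rewrite /jumps big_split_ord big_ord_recl leq_add//=.
  by apply: leq_sum => i _; rewrite /E /= (ltnW (ltn_ord i)) ltn_ord.
apply: leq_trans (leq_addl _ _); apply: leq_sum => i _.
rewrite /E /= /bump /= !add1n !addnS.
by rewrite ltnNge leq_addr ltnNge -addnS leq_addr /= -addSn addKn -addSnnS addKn.
Qed.

(** The length bound behind the Krull-Akizuki theorem. Compute the length of
    [S/sA] through [A] and through [sS]: [len (S/sS) + len (sS/sA) = len (S/A) +
    len (A/sA)], and [len (sS/sA) = len (S/A)], which is finite because [s^t S]
    is inside [A]. *)
Lemma length_le_overmodule s t l S : A s -> s != 0 -> submod S -> A `<=` S ->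
    scale (s ^+ t) S `<=` A -> length_le l A (scale s A) ->
      length_le l S (scale s S).
Proof.
move=> As s0 hS AS sSA hl; have hA' := ring_submod.
have powlen k : exists n, length_le n A (scale (s ^+ k) A).
  elim: k => [|k [n IH]].
    exists 0%N => C m hC; rewrite /jumps big1// => i _.
    case: asboolP => //= ne; exfalso; apply: ne.
    have CA j : C j = A.
      apply/seteqP; split; first exact: chain_sub hC.
      have [_ _ _ AsC] := hC; apply: subset_trans (AsC j).
      by move=> x Ax; exists x; rewrite ?expr0 ?mul1r.
    by rewrite !CA.
  exists (l + n)%N; rewrite exprS -scaleM;
    apply: (@length_le_trans _ _ _ (scale s A)) => //.
  - exact: submod_scale.
  - exact: scale_sub.
  - by apply: scaleS; apply: scale_sub => //; apply: subringX.
  exact: length_le_scale.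
have [n] := powlen t; set st := s ^+ t => hn.
have st0 : st != 0 by rewrite expf_neq0.
have hSA : length_le n S A.
  rewrite -(scaleK S st0) -(scaleK A st0); apply: length_le_scale;
    first by rewrite invr_eq0.
  exact: length_leS hn.
(* a chain of maximal length from [S] to [A], moved below [sS] by scaling *)
have [C [m [k [hC jC hk]]]] := length_le_max hS AS hSA.
have hSsA : length_le (k + l) S (scale s A).
  by apply: (@length_le_trans _ _ _ A) => //; apply: scale_sub.
move=> C' m' hC'.
have hsC : chain (scale s S) (scale s A) (fun i => scale s (C i)).
  have [sC dC C0 CN] := hC.
  by split=> [i|i||i]; [apply: submod_scale|apply: scaleS|apply: scaleS|apply:
    scaleS].
have [E hE jE] := chain_cat m' m (@subset_refl _ _) (scale_sub hS As) (scaleS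
  AS) hC' hsC.
by have := leq_trans jE (hSsA _ _ hE); rewrite jumps_scale// jC addnC leq_add2l.
Qed.

(** [(I + bA)/I] is isomorphic to [A/(I : b)]. *)
Lemma length_le_colon n I b : submod I ->
  length_le n A [set a | A a /\ I (a * b)] -> length_le n (sumset I (scale b A)) I.
Proof.
move=> hI h C m hC; have [sC dC C0 CI] := hC.
pose C' i : set F := [set a | A a /\ C i (a * b)].
have c' : chain A [set a | A a /\ I (a * b)] C'.
  split=> [i|i x [Ax Cx]|x []//|i x [Ax Ix]].
  - have -> : C' i = A `&` [set a | C i (b * a)] by apply/seteqP; split=> x;
      rewrite /C' /= mulrC.
    by apply: submod_cap; [apply: ring_submod|apply: submod_preim].
  - by split=> //; apply: dC.
  by split=> //; apply: CI.
apply: leq_trans (h _ m c'); rewrite leq_sum// => i _.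
case: asboolP => //= Cne; case: asboolP => //= /contrapT e; exfalso; apply: Cne.
apply/seteqP; split=> // x Cx.
have [y Iy [_ [a Aa <-] yx]] := chain_sub hC Cx.
rewrite -yx; apply: submodD => //; first exact: CI.
have : C' i.+1 a; last by case=> _; rewrite mulrC.
rewrite -e; split=> //.
rewrite mulrC (_ : b * a = x - y); last by rewrite -yx addrC addKr.
by apply: submodB => //; apply: CI.
Qed.

Lemma length_le_simple M N : submod M -> submod N -> N `<=` M ->
  (forall J, submod J -> N `<=` J -> J `<=` M -> J = N \/ J = M) -> length_le 1 M N.
Proof.
move=> hM hN NM simp C m hC; have [sC dC C0 CN] := hC.
have NC i : C i = N \/ C i = M by apply: simp => //; apply: chain_sub hC.
have stop i : C i = N -> C i.+1 = N.
  by move=> Ci; apply/seteqP; split=> //; rewrite -Ci.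
suff : (jumps C m <= 1)%N /\ (C m = M -> jumps C m = 0%N) by case.
elim: m => [|m [IH1 IH2]]; first by rewrite /jumps big_ord0.
rewrite /jumps big_ord_recr /= -/(jumps C m).
case: asboolP => [ne|/contrapT <-] /=; last by rewrite addn0.
have CM : C m = M by case: (NC m) => // e; case: ne; rewrite e stop.
rewrite IH2//; split=> // e; case: ne; by rewrite CM.
Qed.

End Length.

(** * Noetherian rings with a discrete valuation ring as integral closure *)

(** [(M + J)/J] is a quotient of [M/N] when [N] is inside the intersection of
    [M] and [J]. *)
Lemma length_le_sumset (F : fieldType) (A : set F) n (M N J : set F) :
    subring A -> submod A M -> submod A J -> N `<=` J -> N `<=` M ->
  length_le A n M N -> length_le A n (sumset M J) J.
Proof.
move=> hA hM hJ NJ NM h C m hC; have [sC dC C0 CJ] := hC.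
have c' : chain A M N (fun i => C i `&` M).
  split=> [i|i x [Cx Mx]|x []//|i x Nx]; first exact: submod_cap.
    by split=> //; apply: dC.
  by split; [apply: CJ; apply: NJ|apply: NM].
apply: leq_trans (h _ m c'); rewrite leq_sum// => i _.
case: asboolP => //= Cne; case: asboolP => //= /contrapT e; exfalso; apply: Cne.
apply/seteqP; split=> // x Cx.
have [y My [z Jz yx]] := chain_sub hC Cx.
have Cz j : C j z by apply: CJ.
rewrite -yx; apply: (submodD hA) => //.
suff [] : (C i.+1 `&` M) y by [].
rewrite -e; split=> //.
rewrite (_ : y = x - z); last by rewrite -yx addrK.
exact: (submodB hA).
Qed.

Section IntegralExtension.
Variables (F : fieldType) (v : F -> int) (A : set F).
Hypothesis hv : discrete_valuation v.
Hypotheses (hA : subring A) (AO : A `<=` vge v 0).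
Hypothesis Aint : forall x, vge v 0 x ->
  exists q, [/\ q \is monic, coefs A q & root q x].
Implicit Types (S : set F) (x y z : F).

Local Notation O := (vge v 0).
Let hO : subring O := vge_subring hv.

Section Overring.
Variable S : set F.
Hypotheses (hS : subring S) (AS : A `<=` S).

(** Multiply a monic equation for [y/x], of degree [n], by [x^n]. *)
Lemma dvd_power x y : S x -> S y -> x != 0 -> O (y / x) ->
  exists n c, S c /\ y ^+ n = x * c.
Proof.
move=> Sx Sy x0 /Aint[q [qm Aq /rootP]].
have [n sq] : exists n, size q = n.+1.
  by exists (size q).-1; rewrite prednK// size_poly_gt0 monic_neq0.
rewrite horner_coef sq big_ord_recr /=.
have -> : q`_n = 1 by rewrite -(monicP qm) lead_coefE sq.
rewrite mul1r; case: n sq => [|n] sq;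
  first by rewrite big_ord0 add0r expr0 => /eqP; rewrite oner_eq0.
move/eqP; rewrite addrC addr_eq0 => /eqP e.
exists n.+1, (- (\sum_(i < n.+1) q`_i * y ^+ i * x ^+ (n - i))); split.
  apply: subringN => //; apply: subring_sum => // i _.
  by apply: subringM; [|apply: subringM; [|apply: AS;
    apply: Aq|apply: subringX]|apply: subringX].
rewrite mulrN mulr_sumr.
have -> : y ^+ n.+1 = x ^+ n.+1 * (y / x) ^+ n.+1
  by rewrite -exprMn mulrCA mulfV// mulr1.
rewrite e mulrN mulr_sumr; congr (- _); apply: eq_bigr => i _.
have -> : x ^+ n.+1 = x * x ^+ (n - i) * x ^+ i.
  by rewrite -mulrA -exprD subnK -?exprS// -ltnS.
rewrite exprMn exprVn; have xi : x ^+ i != 0 by rewrite expf_neq0.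
by field.
Qed.

(** An element that is a unit of the valuation ring is one in any intermediate
    ring, by integrality of its inverse. *)
Lemma unit_inv x : S x -> x != 0 -> v x = 0 -> S x^-1.
Proof.
move=> Sx x0 vx; have [||n [c [Sc]]] := @dvd_power x 1 Sx _ x0.
- exact: subring1.
- by rewrite mul1r; right; rewrite valuationV// vx.
by rewrite expr1n => e; rewrite -[_^-1]mulr1 e mulKf.
Qed.

End Overring.

Variable s : F.
Hypotheses (As : A s) (s0 : s != 0) (vs : 1 <= v s).

Lemma vgeXs n : vge v n%:Z (s ^+ n).
Proof.
apply: (@vgeW _ _ (v s *+ n)); last by apply: vgeX => //; apply: vge_val.
by rewrite -natz ler_wMn2r.
Qed.

(** The maximal ideal is the only nonzero prime of [A], so [s] is nilpotent
    modulo any nonzero [r]. *)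
Lemma conductor_power r : A r -> r != 0 -> exists t c, A c /\ s ^+ t = r * c.
Proof.
move=> Ar r0; have [||n [c [Ac e]]]
  := @dvd_power A hA (@subset_refl _ _) r (s ^+ `|v r|%N) Ar _ r0.
- exact: subringX.
- by apply: (vge_dvd hv r0 _ (vgeXs _)); lia.
by exists (`|v r| * n)%N, c; rewrite exprM.
Qed.

Hypothesis Afrac : forall x, O x -> exists r, [/\ A r, r != 0 & A (r * x)].

Lemma sX_mul_mem x : O x -> exists t, A (s ^+ t * x).
Proof.
move=> /Afrac[r [Ar r0 Arx]]; have [t [c [Ac e]]] := conductor_power Ar r0.
by exists t; rewrite e -mulrA mulrCA; apply: subringM.
Qed.

Lemma sX_mul_le t t' x : (t <= t')%N -> A (s ^+ t * x) -> A (s ^+ t' * x).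
Proof.
move=> tt' Ax; rewrite -(subnK tt') exprD -mulrA; apply: subringM => //.
exact: subringX.
Qed.

Lemma sX_mul_powers x : O x -> exists t, forall i, A (s ^+ t * x ^+ i).
Proof.
move=> Ox; have [q [qm Aq /rootP]] := Aint Ox.
have [n sq] : exists n, size q = n.+1.
  by exists (size q).-1; rewrite prednK// size_poly_gt0 monic_neq0.
rewrite horner_coef sq big_ord_recr /=.
have -> : q`_n = 1 by rewrite -(monicP qm) lead_coefE sq.
rewrite mul1r addrC => /eqP; rewrite addr_eq0 => /eqP e.
(* a common denominator for the powers below the degree serves for all *)
have [t ht] : exists t, forall i, (i < n)%N -> A (s ^+ t * x ^+ i).
  elim: n {sq e} => [|n [t IH]]; first by exists 0%N.
  have [t' h] := sX_mul_mem (subringX hO n Ox).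
  exists (maxn t t') => i; rewrite ltnS leq_eqVlt => /predU1P[->|lt].
    by apply: sX_mul_le h; rewrite leq_maxr.
  by apply: sX_mul_le (IH _ lt); rewrite leq_maxl.
exists t => i; elim/ltn_ind: i => i IH.
have [/ht//|ni] := ltnP i n.
rewrite -(subnK ni) exprD e !mulrN !mulr_sumr; apply: subringN => //.
apply: subring_sum => // j _.
have -> : s ^+ t * (x ^+ (i - n) * (q`_j * x ^+ j)) = q`_j * (s ^+ t * x ^+ (i
  - n + j)).
  by rewrite exprD; ring.
apply: (subringM hA (Aq j)).
by apply: IH; have := ltn_ord j; lia.
Qed.

(** [S] is a fractional ideal of [A] with denominator a power of [s]; for
    subrings between [A] and the valuation ring this replaces finiteness over
    [A]. *)
Definition bounded S := exists t, forall x, S x -> A (s ^+ t * x).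

Lemma adjoin_bounded S w : bounded S -> O w -> bounded (adjoin S w).
Proof.
move=> [t hS] /sX_mul_powers[t' hw]; exists (t + t')%N => _ [q Sq ->].
rewrite horner_coef mulr_sumr; apply: subring_sum => // i _.
by rewrite exprD mulrACA; apply: subringM => //; apply: hS; apply: Sq.
Qed.

Lemma mem_max I x : submod A I -> I `<=` A -> I <> A -> I x -> vge v 1 x.
Proof.
move=> hI IA neq Ix; apply: contrapT => nx; apply: neq.
have [x0 vx] := vge_unit (AO (IA _ Ix)) nx.
apply/seteqP; split=> // a Aa; have -> : a = (a / x) * x by rewrite mulfVK.
apply: (submodM hI) => //; apply: subringM => //.
exact: (unit_inv hA (@subset_refl _ _) (IA _ Ix)).
Qed.

Hypothesis Aacc : forall C : set (set F), C !=set0 -> total_on C subset ->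
  (forall I, C I -> submod A I /\ I `<=` A) -> C (\bigcup_(I in C) I).

(** Otherwise let [I] be maximal among the ideals of infinite colength
    containing [s]. It is not the maximal ideal, so some [a] of positive
    valuation lies outside [I]; as [a] is nilpotent modulo [s], there is a last
    power [b] of [a] outside [I]. Both [I + bA] and [I : b] are strictly larger
    than [I], hence of finite colength, and their colengths add up to that of
    [I]. *)
Lemma finite_length : exists l, length_le A l A (scale s A).
Proof.
apply: contrapT => nfin.
pose fin I := exists l, length_le A l A I.
pose P := [set I | [/\ submod A I, I `<=` A, scale s A `<=` I & ~ fin I]].
have PsA : P (scale s A).
  split=> //; first by apply: submod_scale; apply: ring_submod.
  by apply: (scale_sub (ring_submod hA)).
have [I [[hI IA sAI nI] _ Imax]] : exists I, [/\
  P I, scale s A `<=` I & forall B, P B -> I `<=` B -> B = I].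
  apply: (Zorn_above PsA) => C CP C0 Ctot; apply: (CP); apply: Aacc => // I /CP[].
  by split.
have finb B : submod A B -> B `<=` A -> I `<=` B -> B <> I -> fin B.
  move=> hB BA IB neq; apply: contrapT => nB; apply: neq; apply: Imax => //.
  by split=> //; apply: subset_trans IB.
have hAA := ring_submod hA.
have neIA : I <> A.
  move=> IE; apply: nI; exists 0%N => C m hC; rewrite /jumps big1// => i _.
  case: asboolP => //= ne; exfalso; apply: ne.
  have CA j : C j = A.
    apply/seteqP; split; first exact: chain_sub hC.
    by have [_ _ _] := hC; rewrite IE; apply.
  by rewrite !CA.
pose M := A `&` vge v 1.
have [MI|] := pselect (M `<=` I).
  apply: nI; exists 1%N; apply: length_le_simple => // J hJ IJ JA.
  have [JE|JnA] := pselect (J = A); first by right.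
  by left; apply/seteqP; split=> // x Jx; apply: MI; split;
    [apply: JA|apply: mem_max Jx].
move=> /existsNP[a /not_implyP[[Aa va] nIa]].
have [n [c [Ac e]]] : exists n c, A c /\ (a ^+ `|v s|) ^+ n = s * c.
  apply: dvd_power => //; first exact: subringX.
  apply: (vge_dvd hv s0 (lexx _)); apply: vgeW (vgeX hv _ va).
  by rewrite -[1 *+ _]/(_%:R) natz; lia.
have : exists k, `[< I (a ^+ k) >].
  exists (`|v s| * n)%N; apply/asboolP; rewrite exprM e; apply: sAI.
  by exists c.
move=> /ex_minnP[[|k] /asboolP Ik kmin].
  apply: neIA; apply/seteqP; split=> // x Ax; rewrite -[x]mulr1.
  exact: (submodM hI).
pose b := a ^+ k; have nIb : ~ I b.
  move=> Ib; have : (k < k)%N by apply: kmin; apply/asboolP.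
  by rewrite ltnn.
have Ab : A b by apply: subringX.
pose J := sumset I (scale b A); pose K := [set x | A x /\ I (x * b)].
have hJ : submod A J by apply: submod_sum => //; apply: submod_scale.
have hK : submod A K.
  have -> : K = A `&` [set x | I (b * x)] by apply/seteqP; split=> x;
    rewrite /K /= mulrC.
  by apply: submod_cap => //; apply: submod_preim.
have JA : J `<=` A by apply: (sumset_min hA hAA) => //; apply: (scale_sub hAA).
have IJ : I `<=` J by apply: sumsetl; apply: (submod0 (submod_scale _ hAA)).
have [n1 h1] : fin J.
  apply: finb => // JE; apply: nIb; rewrite -JE; apply: sumsetr;
    first exact: (submod0 hI).
  by exists 1; [apply: subring1|rewrite mulr1].
have [n2 h2] : fin K.
  apply: finb => // [x []//|x Ix|KE]; last first.
    by apply: nIa; rewrite -KE; split=> //; rewrite -exprS.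
  by split; [apply: IA|rewrite mulrC; apply: (submodM hI)].
apply: nI; exists (n1 + n2)%N.
by apply: (length_le_trans hA hAA hJ) => //; apply: length_le_colon.
Qed.

(** Take [S] bounded such that [(S + sO)/sO] has maximal length; the lengths are
    bounded because this module is a quotient of [S/sS]. Adjoining an element
    outside [S + sO] would increase the length. *)
Lemma exists_dense_overring : exists S, [/\
  subring S, A `<=` S, S `<=` O, bounded S &
  forall x, O x -> exists r y, [/\ S r, O y & x = r + s * y]].
Proof.
have [l hl] := finite_length.
have hOm : submod A (scale s O) by apply: submod_scale; apply: subring_submod.
pose good S := [/\ subring S, A `<=` S, S `<=` O & bounded S].
pose P k := `[< exists S C m, [/\ good S,
   chain A (sumset S (scale s O)) (scale s O) C & jumps C m = k] >].
have bA : good A by split=> //; exists 0%N => x; rewrite expr0 mul1r.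
have hSm S : good S -> submod A S by case=> hS AS _ _; apply: subring_submod.
have P0 : exists k, P k.
  exists (jumps (fun _ => scale s O) 0); apply/asboolP;
    exists A, (fun _ => scale s O), 0%N.
  split=> //; split=> // *;
    first [exact: subset_refl | exact: (sumsetr (subring0 hA))].
have Pl k : P k -> (k <= l)%N.
  move=> /asboolP[S [C [m [gS hC <-]]]]; have [hS AS SO [t bS]] := gS.
  suff h : length_le A l (sumset S (scale s O)) (scale s O) by apply: h.
  apply: (@length_le_sumset _ _ _ _ (scale s S)) => //; first exact: hSm.
  - exact: scaleS.
  - by apply: (scale_sub (hSm _ gS)).
  apply: (@length_le_overmodule _ _ hA s t) => //; first exact: hSm.
  by move=> _ [x Sx <-]; apply: bS.
have [k /asboolP[S [C [m [gS hC jC]]]] kmax] := ex_maxnP P0 Pl.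
have [hS AS SO bS] := gS.
exists S; split=> // x Ox; apply: contrapT => nx.
pose S' := adjoin S x.
have hS' : subring S' by apply: adjoin_subring.
have SS' : S `<=` S' by apply: adjoin_sub.
have gS' : good S'.
  split=> //; first exact: subset_trans SS'.
    exact: adjoin_min.
  exact: adjoin_bounded.
pose C' i := if i is j.+1 then C j else sumset S' (scale s O).
have [sC dC C0 CO] := hC.
suff : P k.+1 by move=> /kmax; rewrite ltnn.
apply/asboolP; exists S', C', m.+1; split=> //.
  split=> [[|i]|[|i]||[|i]] //=.
  - by apply: submod_sum => //; apply: hSm.
  - by apply: (subset_trans C0); apply: sumsetS.
  - exact: (sumsetr (subring0 hS')).
rewrite /jumps big_ord_recl /= -/(jumps C m) jC.
suff -> : `[< sumset S' (scale s O) <> C 0 >] by [].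
apply/asboolP => e; apply: nx.
have : C 0 x.
  by rewrite -e; exists x; [apply: adjoin_gen|exists 0; rewrite ?addr0//;
    exists 0; rewrite ?mulr0//; apply: subring0].
by move=> /C0[r Sr [_ [y Oy <-] <-]]; exists r, y.
Qed.

End IntegralExtension.

(** * Frobenius powers in a dense overring *)

Section PowersInOverring.
Variables (F : fieldType) (v : F -> int) (A : set F).
Hypothesis hv : discrete_valuation v.
Hypotheses (hA : subring A) (AO : A `<=` vge v 0).
Hypothesis Aint : forall x, vge v 0 x ->
  exists q, [/\ q \is monic, coefs A q & root q x].
Hypothesis Afrac : forall x, vge v 0 x -> exists r, [/\ A r, r != 0 & A (r * x)].
Variables (s : F) (l : nat).
Hypotheses (As : A s) (s0 : s != 0) (vs : 1 <= v s).
Hypotheses (l_gt0 : (0 < l)%N) (hl : length_le A l A (scale s A)).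
Variable S : set F.
Hypotheses (hS : subring S) (AS : A `<=` S) (SO : S `<=` vge v 0).
Hypothesis Sbounded : bounded A s S.
Hypothesis Sdense : forall x, vge v 0 x ->
  exists r y, [/\ S r, vge v 0 y & x = r + s * y].

Local Notation O := (vge v 0).
Let hO : subring O := vge_subring hv.

Lemma dense_pow n x : O x -> exists r y, [/\ S r, O y & x = r + s ^+ n * y].
Proof.
elim: n x => [|n IH] x Ox.
  by exists 0, x; split=> //; [exact: subring0|rewrite add0r expr0 mul1r].
have [r [y [Sr Oy ->]]] := IH _ Ox; have [r' [y' [Sr' Oy' ->]]] := Sdense Oy.
exists (r + s ^+ n * r'), y'; split=> //; last by rewrite mulrDr exprSr addrA mulrA.
apply: subringD => //; apply: subringM => //; apply: subringX => //.
exact: AS.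
Qed.

Let Ow w : vge v 1 w -> O w. Proof. exact: vgeW. Qed.

Let adjO w : vge v 1 w -> adjoin S w `<=` O.
Proof. by move=> /Ow h; apply: adjoin_min. Qed.

(** With [T = S[w]], the decreasing ideals [w^i T + sT] cannot have [l + 1]
    strict steps, so [w^i] lies in [w^(i+1) T + sT] for some [i <= l], and [1 -
    w a] is a unit of [T]. *)
Lemma pow_in_ideal w : vge v 1 w -> exists2 y, adjoin S w y & w ^+ l = s * y.
Proof.
move=> vw; pose T := adjoin S w.
have hT : subring T by apply: adjoin_subring.
have ST : S `<=` T by apply: adjoin_sub.
have Tw : T w by apply: adjoin_gen.
have AT : A `<=` T by apply: (subset_trans AS).
have Tm : submod A T by apply: subring_submod.
have [t bT] : bounded A s T
  by apply: (adjoin_bounded hv hA Aint As s0 vs Afrac Sbounded (Ow vw)).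
have lT : length_le A l T (scale s T).
  by apply: (length_le_overmodule hA As s0 Tm AT _ hl (t := t)) => _ [x Tx <-];
    apply: bT.
have hsT : submod A (scale s T) by apply: submod_scale.
pose C i := sumset (scale (w ^+ i) T) (scale s T).
have hC : chain A T (scale s T) C.
  split=> [i|i||i].
  - by apply: submod_sum => //; apply: submod_scale.
  - apply: sumsetS => _ [x Tx <-]; exists (w * x); first exact: subringM.
    by rewrite mulrA -exprSr.
  - apply: (sumset_min hA Tm) => _ [x Tx <-]; apply: subringM => //.
      exact: subringX.
    exact: AT.
  exact: (sumsetr (submod0 (submod_scale _ Tm))).
have [i il Ci] : exists2 i, (i <= l)%N & C i = C i.+1.
  apply: contrapT => nC; have := lT _ l.+1 hC; rewrite /jumps.
  rewrite (eq_bigr (fun _ => 1%N)) ?sum1_card ?card_ord ?ltnn// => i _.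
  suff -> : `[< C i <> C i.+1 >] by [].
  by apply/asboolP => e; apply: nC; exists i => //; rewrite -ltnS.
have : C i (w ^+ i).
  exists (w ^+ i); last by exists 0; rewrite ?addr0//; apply: submod0 hsT.
  by exists 1; [apply: subring1|rewrite mulr1].
rewrite Ci => -[_ [a Ta <-] [_ [b Tb <-] e]].
pose u := 1 - w * a.
have Tu : T u by apply: subringB; [|apply: subring1|apply: subringM].
have vu : vge v 1 (w * a) by apply: vgeMr => //; apply: adjO Ta.
have nu : ~ vge v 1 u.
  move=> h; have : vge v 1 1 by rewrite -(subrK (w * a) 1); apply: vgeD.
  by move=> /(vgeE (oner_neq0 _)); rewrite valuation1.
have [u0 vu0] := vge_unit (adjO vw Tu) nu.
have Tui : T u^-1 by apply: (unit_inv hv Aint hT AT).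
have wi : w ^+ i = s * (b / u).
  rewrite mulrA -[s * b](_ : w ^+ i * u = _) ?mulfK//.
  by rewrite /u mulrBr mulr1 mulrA -exprSr -{1}e addrC addKr.
exists (b / u * w ^+ (l - i)); last by rewrite mulrA -wi -exprD subnKC.
apply: subringM => //; first exact: subringM.
exact: subringX.
Qed.

(** By [pow_in_ideal] the powers [w^i] with [i < l] generate [S[w]] modulo [s],
    hence modulo any power of [s], hence outright since a power of [s] carries
    [S[w]] into [S]: a hands-on Nakayama lemma. *)
Lemma adjoin_generated w y : vge v 1 w -> adjoin S w y ->
  exists q, [/\ coefs S q, (size q <= l)%N & y = q.[w]].
Proof.
move=> vw Sy; have [z Sz wl] := pow_in_ideal vw.
pose T := adjoin S w.
have hT : subring T by apply: adjoin_subring.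
have Ss := AS As.
have step x : T x -> exists q x', [/\
  coefs S q, (size q <= l)%N, T x' & x = q.[w] + s * x'].
  move=> [f Sf ->]; exists (take_poly l f), ((drop_poly l f).[w] * z); split.
  - move=> i; rewrite coef_take_poly; case: ifP => // _; exact: subring0.
  - exact: size_take_poly.
  - apply: subringM => //; exists (drop_poly l f) => // i.
    by rewrite coef_drop_poly.
  by rewrite -{1}(poly_take_drop l f) hornerD hornerM hornerXn wl; ring.
have steps n x : T x ->
    exists q x', [/\ coefs S q, (size q <= l)%N, T x' & x = q.[w] + s ^+ n * x'].
  elim: n x => [|n IH] x Tx.
    exists 0, x; rewrite size_poly0 horner0 add0r mul1r; split=> //.
    by rewrite -polyC0; apply: coefsC => //; apply: subring0.
  have [q [x' [Sq lq Tx' ->]]] := step _ Tx;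
    have [q' [x'' [Sq' lq' Tx'' ->]]] := IH _ Tx'.
  exists (q + s *: q'), x''; split=> //.
  - by apply: coefsD => //; apply: coefsZ.
  - by rewrite (leq_trans (size_polyD _ _))// geq_max lq (leq_trans
      (size_scale_leq _ _)).
  by rewrite hornerD hornerZ mulrDr addrA mulrA -exprS.
have [t bT] : bounded A s T
  by apply: (adjoin_bounded hv hA Aint As s0 vs Afrac Sbounded (Ow vw)).
have [q [x' [Sq lq Tx' ->]]] := steps t _ Sy.
exists (q + (s ^+ t * x')%:P); split.
- apply: coefsD => //; apply: coefsC => //; apply: AS; exact: bT.
- by rewrite (leq_trans (size_polyD _ _))// geq_max lq size_polyC (leq_trans
    (leq_b1 _)).
by rewrite hornerD hornerC.
Qed.

(** Let [s^t] be a denominator of [S[c]], write [c = r + x] with [x = s^t w] and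
    [w] of positive valuation. In [x^l = s^(tl) w^l], replace [w^l] by [s] times
    a combination of the [w^i] with [i < l]: each term becomes a multiple of
    [s^t x^i], which lies in [A]. *)
Lemma dense_pow_mem c : O c -> exists r, S r /\
  forall m, (l <= m)%N -> S ((c - r) ^+ m).
Proof.
move=> Oc; pose T := adjoin S c.
have hT : subring T by apply: adjoin_subring.
have [t bT] : bounded A s T
  by apply: (adjoin_bounded hv hA Aint As s0 vs Afrac Sbounded Oc).
have [r [c' [Sr Oc' e]]] := dense_pow t.+1 Oc.
exists r; split=> // m lm; pose w := s * c'.
have vw : vge v 1 w.
  by apply: (vgeMr hv _ Oc'); right.
have xE : c - r = s ^+ t * w by rewrite {1}e /w mulrA -exprSr addrC addKr.
have Tx : T (c - r) by apply: subringB; [|apply: adjoin_gen|apply: adjoin_sub].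
have [y /(adjoin_generated vw)[q [Sq lq ->]] wl] := pow_in_ideal vw.
have -> : (c - r) ^+ m = s * \sum_(i < size q)
    q`_i * (s ^+ (t * (l - i).-1) * (s ^+ t * (c - r) ^+ (i + (m - l)))).
  rewrite -{1}(subnKC lm) exprD {1}xE exprMn wl horner_coef.
  rewrite mulr_sumr mulr_sumr mulr_suml mulr_sumr; apply: eq_bigr => i _.
  have il : (i < l)%N by apply: leq_trans lq.
  have -> : s ^+ t ^+ l = s ^+ (t * (l - i).-1) * s ^+ t * (s ^+ t) ^+ i.
    rewrite -!exprM -!exprD; congr (_ ^+ _).
    by rewrite -mulnSr prednK ?subn_gt0// -mulnDr subnK// ltnW.
  rewrite exprD (_ : (c - r) ^+ i = (s ^+ t) ^+ i * w ^+ i);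
    last by rewrite xE exprMn.
  move: (s ^+ (_ * _)) (s ^+ t) (w ^+ i) ((c - r) ^+ (m - l)) => a b d f.
  by move: (b ^+ i) => g; ring.
apply: subringM => //; first exact: AS.
apply: subring_sum => // i _; apply: (subringM hS (Sq i)).
apply: AS; apply: subringM => //; first exact: subringX.
by apply: bT; apply: subringX.
Qed.

(** The exponent is uniform in [c]: once [p^e >= l], Frobenius separates [c = r
    + x] into [r^q + x^q]. *)
Lemma frobenius_power_mem p : p \in [pchar F] ->
  exists e, forall c, O c -> S (c ^+ (p ^ e)).
Proof.
move=> hp; have p1 := prime_gt1 (pcharf_prime hp).
exists l => c /dense_pow_mem[r [Sr h]].
have pq : [pchar F].-nat (p ^ l)%N.
  by rewrite (eq_pnat _ (pcharf_eq hp)) pnatX pnat_id ?(pcharf_prime hp).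
have := exprDn_pchar r (c - r) pq; rewrite [r + _]addrC subrK => ->.
apply: subringD => //; first exact: subringX.
by apply: h; apply: ltnW; apply: ltn_expl.
Qed.

End PowersInOverring.

(** * The residue field of a discrete valuation *)

Section ResidueField.
Variables (F : fieldType) (v : F -> int).
Hypothesis hv : discrete_valuation v.

Definition valuation_pred : {pred F} := fun x => `[< vge v 0 x >].

Lemma valuation_pred_subring : subring_closed valuation_pred.
Proof.
have [O1 OB OM] := vge_subring hv.
split=> [|x y /asboolP Ox /asboolP Oy|x y /asboolP Ox /asboolP Oy];
  apply/asboolP => //.
  exact: OB.
exact: OM.
Qed.

HB.instance Definition _ :=
  GRing.isSubringClosed.Build F valuation_pred valuation_pred_subring.

Record valuationRing := ValuationRing {
  valuationRing_val :> F;
  _ : valuationRing_val \in valuation_pred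
}.

HB.instance Definition _ := [isSub for valuationRing_val].
HB.instance Definition _ := [Choice of valuationRing by <:].
HB.instance Definition _ := [SubChoice_isSubComNzRing of valuationRing by <:].

Definition maximal_pred : {pred valuationRing} := fun x => `[< vge v 1 (val x) >].

Lemma maximal_pred_ideal : idealr_closed maximal_pred.
Proof.
split; first by apply/asboolP; left.
  apply/asboolP => h; have : vge v 1 1 := h.
  by move=> /(vgeE (oner_neq0 F)); rewrite valuation1.
move=> a x y /asboolP mx /asboolP my; apply/asboolP.
change (vge v 1 (val a * val x + val y)).
by apply: vgeD => //; apply: vgeMl => //; case: a => a /= /asboolP.
Qed.

HB.instance Definition _ :=
  isIdealr.Build valuationRing maximal_pred maximal_pred_ideal.

Definition residue := Quotient.quot maximal_pred.

HB.instance Definition _ := GRing.ComNzRing.on residue.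

Definition to_residue : valuationRing -> residue :=
  \pi_(Quotient.quot maximal_pred)%qT.

Lemma to_residue_eq (x y : valuationRing) :
  reflect (to_residue x = to_residue y) (x - y \in maximal_pred).
Proof. by rewrite Quotient.idealrBE; apply: eqP. Qed.

Lemma to_residueB : {morph to_residue : x y / x - y}.
Proof. exact: rmorphB. Qed.

Lemma to_residueM : {morph to_residue : x y / x * y}.
Proof. exact: rmorphM. Qed.

Lemma to_residue1 : to_residue 1 = 1. Proof. exact: rmorph1. Qed.

Lemma residue_inv (z : residue) : exists w, (z != 0 -> w * z = 1) /\
  (z = 0 -> w = 0).
Proof.
have [->|z0] := eqVneq z 0; first by exists 0; split=> //; rewrite eqxx.
have zE : to_residue (repr z) = z by rewrite /to_residue reprK.
move: (repr z) zE => x zE.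
have Ox : vge v 0 (val x) by apply/asboolP; apply: (valP x).
have nx : ~ vge v 1 (val x).
  move=> mx; move/eqP: z0; apply; rewrite -zE.
  have <- : to_residue 0 = 0 by exact: rmorph0.
  by apply/to_residue_eq; rewrite subr0; apply/asboolP.
have [x0 vx] := vge_unit Ox nx.
have Oxi : (val x)^-1 \in valuation_pred by apply/asboolP; right;
  rewrite valuationV// vx.
exists (to_residue (ValuationRing Oxi)); split; last by move=> /eqP;
  rewrite (negPf z0).
move=> _; rewrite -zE -to_residueM -to_residue1.
congr to_residue; apply: val_inj.
by change ((val x)^-1 * val x = 1); rewrite mulVf.
Qed.

(** The residue field is described by its reduction map, extended arbitrarily
    outside the valuation ring. *)
Lemma residue_field : exists (k : fieldType) (res : F -> k), [/\
  forall x y, vge v 0 x -> vge v 0 y -> res (x - y) = res x - res y,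
  forall x y, vge v 0 x -> vge v 0 y -> res (x * y) = res x * res y,
  res 1 = 1,
  forall x, vge v 0 x -> res x = 0 <-> vge v 1 x &
  forall z, exists2 x, vge v 0 x & res x = z].
Proof.
have [inv invP] := choice residue_inv.
pose fieldmixin := GRing.ComNzRing_isField.Build residue
  (fun x => (invP x).1) ((invP 0).2 (erefl 0)).
pose k : fieldType := HB.pack residue fieldmixin.
pose res (x : F) : k := to_residue (insubd 0 x).
have O x : vge v 0 x -> x \in valuation_pred by move=> ?; apply/asboolP.
have resE x (Ox : x \in valuation_pred) : res x = to_residue (ValuationRing Ox).
  by congr to_residue; apply: val_inj; rewrite /= insubdK.
exists k, res; split.
- move=> x y /O Ox /O Oy; rewrite !resE ?rpredB// => Oxy.
  by rewrite -to_residueB; congr to_residue; apply: val_inj.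
- move=> x y /O Ox /O Oy; rewrite !resE ?rpredM// => Oxy.
  rewrite -to_residueM; congr to_residue; exact: val_inj.
- rewrite resE ?rpred1// => O1; rewrite -to_residue1; congr to_residue;
    exact: val_inj.
- move=> x /O Ox; rewrite resE.
  have <- : to_residue 0 = 0 by exact: rmorph0.
  by split=> [/to_residue_eq|h];
    [rewrite subr0 => /asboolP|apply/to_residue_eq; rewrite subr0; apply/asboolP].
move=> z; have zE : to_residue (repr z) = z by rewrite /to_residue reprK.
exists (val (repr z)); first by apply/asboolP; apply: (valP (repr z)).
by rewrite -[RHS]zE /res valKd.
Qed.

End ResidueField.

(** * Maximal subfields and density *)

Lemma modz_dvd_eq (p i j : nat) (a b : int) : (i < p)%N -> (j < p)%N ->
  (p %| `|a|)%N -> (p %| `|b|)%N -> a + i%:Z = b + j%:Z -> i = j.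
Proof.
move=> ip jp pa pb.
have /dvdzP[c ->] : (p %| a)%Z by rewrite dvdzE.
have /dvdzP[d ->] : (p %| b)%Z by rewrite dvdzE.
move=> /(congr1 (fun x => (x %% p)%Z)); rewrite !modzMDl !modz_small//.
by case.
Qed.

Lemma dvd_ge0 (p i : nat) (a : int) : (i < p)%N -> (p %| `|a|)%N ->
  0 <= a + i%:Z -> 0 <= a.
Proof.
move=> ip pa ai; rewrite leNgt; apply/negP => a0.
have /dvdn_leq/(_ pa) : (0 < `|a|)%N by move: a0; lia.
by move: a0 ai ip; lia.
Qed.

Section DenseSubfield.
Variables (F : fieldType) (v : F -> int) (p : nat).
Hypothesis hv : discrete_valuation v.
Hypothesis hp : p \in [pchar F].

Local Notation O := (vge v 0).
Let hO : subring O := vge_subring hv.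

(** The term of smallest valuation would dominate the sum. *)
Lemma sum_distinct_val n (f : nat -> F) :
  (forall i j, (i < n)%N -> (j < n)%N -> f i != 0 -> f j != 0 ->
    v (f i) = v (f j) -> i = j) ->
  O (\sum_(i < n) f i) -> forall i, (i < n)%N -> O (f i).
Proof.
move=> inj hsum i lti; apply: contrapT => nOi.
have fi0 : f i != 0 by apply/negP => /eqP e; apply: nOi; rewrite e; left.
pose i0 := Ordinal lti.
have [j fj0 jmin] : exists2 j : 'I_n, f j != 0
  & forall k : 'I_n, f k != 0 -> v (f j) <= v (f k).
  by case: (@arg_minP _ _ _ i0 (fun k : 'I_n => f k != 0) (fun k => v (f k))
    fi0) => j; exists j.
have vj : v (f j) < 0.
  rewrite ltNge; apply/negP => h; apply: nOi; right.
  exact: (le_trans h (jmin i0 fi0)).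
rewrite (bigD1 j)//= in hsum.
have := valuation_dom hv fj0 (_ : vge v _ (\sum_(k < n | k != j) f k)).
case.
  apply: vge_sum => // k kj; have [->|fk0] := eqVneq (f k) 0; first by left.
  right; rewrite lezD1 lt_neqAle jmin// andbT; apply/negP => /eqP e.
  by move/negP: kj; apply; apply/eqP/val_inj;
    exact: (inj k j (ltn_ord k) (ltn_ord j) fk0 fj0 (esym e)).
move=> s0 vs; have := vgeE s0 hsum; rewrite vs.
by rewrite leNgt vj.
Qed.

(** Divide [f] by its coefficient of smallest valuation, assumed negative: the
    quotient has coefficients in the valuation ring, some coefficient 1, and a
    value of positive valuation at [r]. Its reduction is a nonzero polynomial of
    degree less than [p] over the residue field of [K], vanishing at the residue
    of [r]; by [insep_root] this residue comes from [K]. *)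
Lemma coefs_residual (K : set F) r f : subfield K -> (forall x, K (x ^+ p)) ->
  O r ->
  (forall k, K k -> ~ vge v 1 (r - k)) ->
  coefs K f -> (size f <= p)%N -> O f.[r] -> coefs O f.
Proof.
move=> hK Kp Or nr Kf szf Ofr i; apply: contrapT => nOi; have Kr := subfieldB hK.
have [k [res [resB resM res1 res0P res_surj]]] := residue_field hv.
have O0 : O 0 by left.
have r00 : res 0 = 0 by rewrite -(subrr 0) resB// subrr.
have resD x y : O x -> O y -> res (x + y) = res x + res y.
  move=> Ox Oy; rewrite -[y in LHS]opprK resB//; last exact: vgeN.
  by rewrite -[- y]sub0r resB// r00 sub0r opprK.
have resX x n : O x -> res (x ^+ n) = res x ^+ n.
  move=> Ox; elim: n => [|n IH]; first exact: res1.
  by rewrite !exprS resM// ?IH//; apply: subringX.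
have res_sum n (g : nat -> F) : (forall j, O (g j)) ->
    res (\sum_(j < n) g j) = \sum_(j < n) res (g j).
  move=> Og; elim: n => [|n IH]; first by rewrite !big_ord0.
  by rewrite !big_ord_recr /= resD ?IH//; apply: subring_sum.
have pk : p \in [pchar k].
  rewrite inE (pcharf_prime hp) /=; apply/eqP.
  have resn n : res n%:R = n%:R.
    by elim: n => // n IH; rewrite -addn1 !natrD resD ?IH ?res1//;
      apply: subringMn => //; apply: subring1.
  by rewrite -resn (pcharf0 hp) r00.
pose L : set k := [set res x | x in K `&` O].
have hL : subfield L.
  split; [split|].
  - by exists 1 => //; split; apply: subring1.
  - move=> _ _ [x [Kx Ox] <-] [y [Ky Oy] <-]; exists (x - y); rewrite ?resB//.
    by split; apply: subringB.
  - move=> _ _ [x [Kx Ox] <-] [y [Ky Oy] <-]; exists (x * y); rewrite ?resM//.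
    by split; apply: subringM.
  move=> _ [x [Kx Ox] <-]; have [e|/eqP ne] := eqVneq (res x) 0.
    by rewrite e invr0; exists 0 => //; split=> //; apply: subring0.
  have [|x0 vx] := @vge_unit _ _ x Ox; first by move=> /(res0P _ Ox).
  have Oxi : O x^-1 by right; rewrite valuationV// vx.
  exists x^-1; first by split=> //; apply: subfieldV.
  by apply: (mulfI (_ : res x != 0)); [apply/eqP | rewrite -resM// !mulfV//;
    apply/eqP].
have Lp z : L (z ^+ p).
  have [x Ox <-] := res_surj z; exists (x ^+ p); last exact: resX.
  by split=> //; apply: subringX.
have fi0 : f`_i != 0 by apply/negP => /eqP e; apply: nOi; rewrite e; left.
have ltis : (i < size f)%N by rewrite ltnNge; apply/negP => h; move: fi0;
  rewrite nth_default ?eqxx.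
pose i0 := Ordinal ltis.
have [j fj0 jmin] : exists2 j : 'I_(size f), f`_j != 0 &
    forall k : 'I_(size f), f`_k != 0 -> v f`_j <= v f`_k.
  by case: (@arg_minP _ _ _ i0 (fun k : 'I_(size f) => f`_k != 0) (fun k => v
    f`_k) fi0) => j; exists j.
have vj : v f`_j < 0.
  rewrite ltNge; apply/negP => h; apply: nOi; right.
  exact: (le_trans h (jmin i0 fi0)).
pose g n := f`_n / f`_j.
have Og n : O (g n).
  have [e|fn0] := eqVneq f`_n 0; first by rewrite /g e mul0r; left.
  have ltn : (n < size f)%N by rewrite ltnNge; apply/negP => h; move: fn0;
    rewrite nth_default ?eqxx.
  by apply: (vge_dvd hv fj0 (jmin (Ordinal ltn) fn0)); apply: vge_val.
have Kg n : K (g n) by apply: subringM => //; apply: subfieldV.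
pose gb : {poly k} := \poly_(n < size f) res (g n).
have gbL : coefs L gb.
  move=> n; rewrite coef_poly; case: ifP => _; last exact: subring0 (subfieldB hL).
  by exists (g n).
have gb0 : gb != 0.
  apply/negP => /eqP/(congr1 (fun q : {poly k} => q`_j)).
  by rewrite coef_poly ltn_ord /g mulfV// res1 coef0 => /eqP; rewrite oner_eq0.
have gbr : root gb (res r).
  rewrite rootE horner_poly; apply/eqP.
  transitivity (res (\sum_(n < size f) g n * r ^+ n)).
    rewrite (res_sum _ (fun n => g n * r ^+ n)).
      by apply: eq_bigr => n _; rewrite (resM (g n) (r ^+ n)) ?resX//;
        exact: (subringX hO).
    by move=> n; apply: subringM => //; apply: subringX.
  have e : \sum_(n < size f) g n * r ^+ n = f.[r] / f`_j.
    by rewrite horner_coef mulr_suml; apply: eq_bigr => n _; rewrite /g mulrAC.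
  have h : vge v 1 (f.[r] / f`_j).
    by apply: vgeW (vge_div hv fj0 Ofr); move: vj; lia.
  by rewrite e; apply/res0P => //; apply: vgeW h.
have [x [Kx Ox] e] := insep_root pk hL Lp gb0 gbL (leq_trans (size_poly _ _)
  szf) gbr.
by apply: (nr x Kx); apply/res0P; [apply: subringB|rewrite resB// e subrr].
Qed.

(** The value group of [K] contains [p]; if it contained an integer prime to
    [p], it would contain 1 by Bezout's identity. *)
Lemma val_dvd_pchar (K : set F) : subfield K -> (forall x, K (x ^+ p)) ->
  (forall k, K k -> k != 0 -> v k <> 1) ->
  forall k, K k -> k != 0 -> (p %| `|v k|)%N.
Proof.
move=> hK Kp nK k Kk k0; have Kr := subfieldB hK; have pp := pcharf_prime hp.
apply: contrapT => /negP np.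
wlog vk : k Kk k0 np / 0 <= v k => [th|].
  have [|h] := leP 0 (v k); first exact: th np.
  apply: (th k^-1); rewrite ?invr_eq0//; first exact: subfieldV.
    by rewrite valuationV// abszN.
  by rewrite valuationV//; move: h; lia.
have n0 : (0 < `|v k|)%N by rewrite lt0n; apply/negP => /eqP e; move: np;
  rewrite e dvdn0.
case: (egcdnP p n0) => a b eab _.
have co : gcdn `|v k| p = 1%N by apply/eqP;
  rewrite -/(coprime _ _) coprime_sym prime_coprime.
have [t t0 vt] := exists_val hv 1.
have tp0 : (t ^+ p) ^+ b != 0 by rewrite !expf_neq0.
have ka0 : k ^+ a != 0 by rewrite expf_neq0.
apply: (nK (k ^+ a / (t ^+ p) ^+ b)).
- by apply: subringM => //; [apply: subringX|apply: subfieldV => //;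
    apply: subringX].
- by rewrite mulf_neq0// invr_eq0.
rewrite valuationM ?invr_eq0// valuationV// !valuationX ?expf_neq0// vt co in eab *.
have vn : v k = (`|v k|%N)%:R by rewrite natz gez0_abs.
rewrite vn -[X in X - _]mulr_natl -[X in _ - X]mulr_natl -natrM eab natrD natrM.
by rewrite addrAC subrr add0r.
Qed.

Variables (T : set F) (u : F).
Hypotheses (hT : subring T) (TO : T `<=` O) (OpT : forall x, O x -> T (x ^+ p)).
Hypotheses (Tu : T u) (vu : v u = 1) (u0 : u != 0).
Hypothesis Tres : forall x, O x -> exists2 r, T r & vge v 1 (x - r).

(** Take [K] maximal among the subfields containing the [p]-th powers with [K /\
    O] inside [T]. Adjoining [b] in [T] preserves this condition as soon as
    polynomials of degree less than [p] over [K] with value in [O] at [b] have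
    coefficients in [O]. If [K] contained no uniformizer, this would hold for [b
    = u], the terms having distinct valuations modulo [p]; if [K] missed the
    residue of [r], it would hold for [b = r] by [coefs_residual]. A subfield
    with a uniformizer and all residues is dense. *)
Lemma exists_dense_subfield : exists K, [/\ subfield K, forall x, K (x ^+ p),
  K `&` O `<=` T & forall x, exists a k, [/\ O a, K k & x = a + k]].
Proof.
have p0 := pchar_gt0 hp.
pose P := [set K | [/\ subfield K, forall x, K (x ^+ p) & K `&` O `<=` T]].
pose K0 : set F := range (fun x => x ^+ p).
have PK0 : P K0.
  split; last 2 first.
  - by move=> x; exists x.
  - by move=> _ [[x _ <-] /(vge_root hv p0) Ox]; apply: OpT.
  split; [split|].
  - by exists 1; rewrite ?expr1n.
  - move=> _ _ [x _ <-] [y _ <-]; exists (x - y) => //.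
    by rewrite -!(pFrobenius_autE hp) pFrobenius_autB_comm//; apply: mulrC.
  - by move=> _ _ [x _ <-] [y _ <-]; exists (x * y) => //; rewrite exprMn.
  by move=> _ [x _ <-]; exists x^-1 => //; rewrite exprVn.
have [K [[hK Kp KOT] _ Kmax]] : exists K, [/\
  P K, K0 `<=` K & forall B, P B -> K `<=` B -> B = K].
  apply: (Zorn_above PK0) => C CP [L CL] Ctot; split.
  - by apply: subfield_bigcup => //; [exists L|move=> M /CP[]].
  - by move=> x; exists L => //; have [_ h _] := CP _ CL; apply: h.
  by move=> x [[M CM Mx] Ox]; have [_ _ h] := CP _ CM; apply: h.
have Kr := subfieldB hK.
have maxK b : adjoin K b `&` O `<=` T -> K b.
  move=> h; have <- : adjoin K b = K; last exact: adjoin_gen.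
  apply: Kmax; last exact: adjoin_sub.
  split=> //; first exact: (adjoin_subfield hp).
  by move=> x; apply: adjoin_sub.
have horner_T b f : coefs K f -> T b -> (forall i, O f`_i) -> T f.[b].
  move=> Kf Tb Of; rewrite horner_coef; apply: subring_sum => // i _.
  by apply: subringM => //; [apply: KOT|apply: subringX].
have [k1 [Kk1 k10 vk1]] : exists k, [/\ K k, k != 0 & v k = 1].
  apply: contrapT => nK.
  have dK := val_dvd_pchar hK Kp (fun k Kk k0 vk => nK (ex_intro _ k (And3 Kk
    k0 vk))).
  apply: nK; exists u; split=> //; apply: maxK.
  move=> _ [/(adjoin_small hp hK Kp)[f [Kf szf ->]] Of]; apply: horner_T => // i.
  have ui n : u ^+ n != 0 by rewrite expf_neq0.
  have [szi|ltis] := leqP (size f) i; first by rewrite nth_default//; left.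
  have [->|fi0] := eqVneq f`_i 0; first by left.
  have Ofi : O (f`_i * u ^+ i).
    apply: (@sum_distinct_val (size f) (fun i => f`_i * u ^+ i)) => //;
      last by rewrite -horner_coef.
    move=> j k jf kf; rewrite !mulf_eq0 !negb_or => /andP[fj _] /andP[fk _].
    rewrite !valuationM// !valuationX// vu !natz.
    apply: modz_dvd_eq; [exact: leq_trans szf|exact: leq_trans szf| |]; exact: dK.
  have /(vgeE (mulf_neq0 fi0 (ui i))) := Ofi;
    rewrite valuationM// valuationX// vu natz => h.
  by right; apply: dvd_ge0 (leq_trans ltis szf) _ h; apply: dK.
have resK b : O b -> exists2 k, K k & vge v 1 (b - k).
  move=> /Tres[r Tr br].
  suff [k Kk rk] : exists2 k, K k & vge v 1 (r - k).
    by exists k => //; rewrite -(subrK r b) -addrA; apply: vgeD.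
  apply: contrapT => nK.
  have nr k : K k -> ~ vge v 1 (r - k) by move=> Kk h; apply: nK; exists k.
  apply: (nr r); last by rewrite subrr; left.
  apply: maxK => _ [/(adjoin_small hp hK Kp)[f [Kf szf ->]] Of];
    apply: horner_T => //.
  exact: (coefs_residual hK Kp (TO Tr) nr).
exists K; split=> // x.
have [->|x0] := eqVneq x 0.
  by exists 0, 0; rewrite addr0; split=> //; [left|apply: subring0].
have [n hn] : exists n : nat, vge v (- n%:Z) x by exists `|v x|%N; right; lia.
elim: n x {x0} hn => [|n IH] x hx.
  by exists x, 0; rewrite addr0; split=> //; [apply: subring0].
pose y := k1 ^+ n.+1; have y0 : y != 0 by rewrite expf_neq0.
have vy : v y = n.+1%:Z by rewrite valuationX// vk1 natz.
have Oxy : O (x * y) by have := vgeM hv hx (vge_val v y); rewrite vy addNr.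
have [k Kk hk] := resK _ Oxy.
have [|a [k' [Oa Kk' e]]] := IH (x - k / y).
  have -> : x - k / y = (x * y - k) / y by rewrite mulrBl mulfK.
  by apply: vgeW (vge_div hv y0 hk); rewrite vy; lia.
exists a, (k' + k / y); split=> //; last by rewrite addrA -e subrK.
by apply: subringD => //; apply: subringM => //; apply: subfieldV => //;
  apply: subringX.
Qed.

End DenseSubfield.

(** * From the Noetherian ring to the subfield *)

Lemma frac_quotient (R : idomainType) (x : {fraction R}) :
  exists a b : R, b != 0 /\ x = a%:F / b%:F.
Proof.
pose r := repr x; exists r.1, r.2; have d0 := denom_ratioP r; split=> //.
suff e : x * (r.2)%:F = (r.1)%:F by rewrite -e mulfK// tofrac_eq0.
rewrite -[x]reprK -/r; unlock FracField.tofrac.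
rewrite -[LHS]FracField.pi_mul; apply/eqmodP.
rewrite /= FracField.equivfE /FracField.mulf !numden_Ratio ?oner_neq0 ?mulr1//.
by rewrite mulrC.
Qed.

Lemma smallest_subring (F : fieldType) (G : set F) : subring (smallest
  (@subring F) G).
Proof.
split=> [S [hS _]|x y Gx Gy S hS|x y Gx Gy S hS]; first exact: subring1.
  by apply: subringB; [case: hS|apply: Gx|apply: Gy].
by apply: subringM; [case: hS|apply: Gx|apply: Gy].
Qed.

Section BoundedOrDense.
Variables (F : fieldType) (v : F -> int) (A : set F).
Hypothesis hv : discrete_valuation v.
Hypotheses (hA : subring A) (AO : A `<=` vge v 0).
Hypothesis Aint : forall x, vge v 0 x ->
  exists q, [/\ q \is monic, coefs A q & root q x].
Hypothesis Afrac : forall x, vge v 0 x -> exists r, [/\ A r, r != 0 & A (r * x)].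
Local Notation O := (vge v 0).

Lemma exists_nonunit : exists s, [/\ A s, s != 0 & 1 <= v s].
Proof.
have [u u0 vu] := exists_val hv 1.
have [|r [Ar r0 Aru]] := Afrac (x := u); first by right; rewrite vu.
have ru0 : r * u != 0 by rewrite mulf_neq0.
exists (r * u); split=> //; rewrite (valuationM hv)// vu.
by have := vgeE r0 (AO Ar); lia.
Qed.

Variable p : nat.
Hypothesis hp : p \in [pchar F].
Hypothesis Aacc : forall C : set (set F), C !=set0 -> total_on C subset ->
  (forall I, C I -> submod A I /\ I `<=` A) -> C (\bigcup_(I in C) I).

(** The dichotomy is whether the ring [T 1] generated by [S] and the [p]-th
    powers is the whole valuation ring. If it is, Frobenius carries this to [O =
    T k] for all [k], and [T e] is [S]. *)
Lemma bounded_or_dense s : A s -> s != 0 -> 1 <= v s ->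
  bounded A s O \/ exists K, [/\ subfield K, forall x, K (x ^+ p),
    exists x, ~ K x & forall x, exists a k, [/\ O a, K k & x = a + k]].
Proof.
move=> As s0 vs; have hO := vge_subring hv.
have [l hl] := finite_length hv hA AO Aint As s0 vs Aacc.
have [S [hS AS SO bS Sd]] := exists_dense_overring hv hA AO Aint As s0 vs Afrac
  Aacc.
have {}hl : length_le A l.+1 A (scale s A) by apply: length_leS hl.
have [e Oe] := frobenius_power_mem hv hA Aint Afrac As s0 vs (ltn0Sn l) hl hS
  AS SO bS Sd hp.
pose gen k := S `|` [set x ^+ (p ^ k) | x in O].
pose T k := smallest (@subring F) (gen k).
have hT k : subring (T k) := smallest_subring (gen k).
have ST k : S `<=` T k by move=> x Sx; apply: sub_gen_smallest; left.
have OT k x : O x -> T k (x ^+ (p ^ k)).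
  by move=> Ox; apply: sub_gen_smallest; right; exists x.
have TO k : T k `<=` O.
  by apply: smallest_sub => // x [/SO//|[y Oy <-]]; apply: subringX.
have [OT1|] := pselect (O `<=` T 1%N).
  left; suff OS : O `<=` S by have [t h] := bS; exists t => x /OS; apply: h.
  have OTk k : O `<=` T k.
    elim: k => [|k IH] x Ox; first by have := OT 0%N x Ox; rewrite expn0 expr1.
    have TT : T k `<=` T k.+1; last by apply: TT; apply: IH.
    apply: smallest_sub => // z [/ST//|[y Oy <-]].
    (* this set is a subring, by additivity of Frobenius *)
    suff : T 1%N `<=` [set z | T k.+1 (z ^+ (p ^ k))] by apply; apply: OT1.
    have pk : [pchar F].-nat (p ^ k)%N.
      by rewrite (eq_pnat _ (pcharf_eq hp)) pnatX pnat_id ?(pcharf_prime hp).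
    apply: smallest_sub => [|t [St|[t' Ot' <-]]] /=.
    - split=> [|a b Ta Tb|a b Ta Tb] /=; first by rewrite expr1n;
        exact: (subring1 (hT k.+1)).
        have -> : (a - b) ^+ (p ^ k) = a ^+ (p ^ k) - b ^+ (p ^ k).
          by have := exprDn_pchar (a - b) b pk; rewrite subrK => ->; rewrite addrK.
        exact: (subringB (hT k.+1)).
      by rewrite exprMn; apply: (subringM (hT k.+1)).
    - exact: (subringX (hT k.+1) _ (ST _ _ St)).
    by rewrite -exprM -expnD add1n; apply: OT.
  apply: subset_trans (OTk e) _; apply: smallest_sub => // x [//|[y Oy <-]].
  exact: Oe.
move=> nOT; right.
have Tres x : O x -> exists2 r, S r & vge v 1 (x - r).
  move=> /Sd[r [y [Sr Oy ->]]]; exists r => //.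
  by rewrite addrC addKr; apply: vgeMr => //; right.
have [u [Tu u0 vu]] : exists u, [/\ S u, u != 0 & v u = 1].
  (* [S] has a uniformizer: [s], or the component in [S] of any uniformizer *)
  have [vs1|vs1] := eqVneq (v s) 1; first by exists s; split=> //; apply: AS.
  have [t t0 vt] := exists_val hv 1.
  have [|r [y [Sr Oy tE]]] := Sd t; first by right; rewrite vt.
  have rE : r = t + - (s * y) by rewrite tE addrK.
  have [|r0 vr] := valuation_dom hv t0 (_ : vge v _ (- (s * y))).
    apply: vgeN => //; apply: (vgeMr hv _ Oy); right; rewrite vt.
    by move: vs vs1; lia.
  by exists r; rewrite rE; split=> //; [rewrite -rE|rewrite vr].
have Op x : O x -> T 1%N (x ^+ p) by move=> /(OT 1%N); rewrite expn1.
have [||K [hK Kp KT Kd]] := exists_dense_subfield hv hp (hT 1%N) (TO 1%N) Op _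
  vu u0.
- exact: ST.
- by move=> x /Tres[r Sr xr]; exists r => //; apply: ST.
exists K; split=> //; apply: contrapT => nK; apply: nOT => x Ox.
by apply: KT; split=> //; apply: contrapT => nKx; apply: nK; exists x.
Qed.

End BoundedOrDense.

Section Completion.
Variables (R : comNzRingType) (M : set R).

Lemma cauchy_classX (u : cauchySeq M) n : cauchy_class (u ^+ n) = cauchy_class
  u ^+ n.
Proof.
elim: n => // n IH; rewrite [LHS](_ : _ = cauchy_class (u * u ^+ n));
  last by rewrite exprS.
by rewrite cauchy_class_mul IH exprS.
Qed.

Lemma cauchy_class_eq0 (u : cauchySeq M) :
  cauchy_class u = 0 <-> u \in @adic_null R M.
Proof.
have -> : 0 = cauchy_class (0 : cauchySeq M).
  by apply: (addrI (cauchy_class 0)); rewrite -cauchy_classD !addr0.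
by split=> [/cauchy_class_eqP|h]; [rewrite subr0|apply/cauchy_class_eqP;
  rewrite subr0].
Qed.

Lemma cauchy_seqX (u : cauchySeq M) n i : (u ^+ n) i = u i ^+ n.
Proof.
by elim: n => [|n IH]; rewrite ?exprS// -IH.
Qed.

Lemma ideal_exp_pow s n r : M s -> ideal_exp M n (s ^+ n * r).
Proof.
move=> Ms; rewrite mulrC; apply: ideal_expM => I [_ sub]; apply: sub.
by exists (fun _ => s) => //=; rewrite prodr_const card_ord.
Qed.

End Completion.

Lemma ideal_exp_vge (F : fieldType) (v : F -> int) (R : comNzRingType)
    (rho : {rmorphism R -> F}) (M : set R) n r : discrete_valuation v ->
    (forall x, vge v 0 (rho x)) -> (forall x, M x -> vge v 1 (rho x)) ->
  ideal_exp M n r -> vge v n%:Z (rho r).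
Proof.
move=> hv RO MO; move: r; suff : ideal_exp M n `<=` [set r | vge v n%:Z (rho
  r)] by [].
apply: smallest_sub => /=.
  split=> [|a x y Ix Iy] /=; first by rewrite rmorph0; left.
  by rewrite rmorphD rmorphM; apply: vgeD => //; apply: vgeMl.
move=> _ [a Ma <-] /=; rewrite rmorph_prod.
have -> : n%:Z = \sum_(i < n) 1%:Z by rewrite sumr_const card_ord -natz.
elim/big_ind2: _ => //.
- exact: vge1.
- by move=> *; apply: vgeM.
by move=> i _; apply: MO; apply: Ma.
Qed.

Section AnalyticallyRamified.
Variables (F : fieldType) (v : F ->
  int) (R : idomainType) (rho : {rmorphism R -> F}).
Hypothesis hv : discrete_valuation v.
Hypothesis rho_inj : injective rho.

Let A : set F := range rho.
Local Notation O := (vge v 0).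

Hypothesis AO : A `<=` O.
Hypothesis Aint : forall x, O x -> exists q, [/\ q \is monic, coefs A q & root q x].

Lemma range_subring : subring A.
Proof.
split; first by exists 1; rewrite ?rmorph1.
  by move=> _ _ [x _ <-] [y _ <-]; exists (x - y); rewrite ?rmorphB.
by move=> _ _ [x _ <-] [y _ <-]; exists (x * y); rewrite ?rmorphM.
Qed.

(** A finite set of generators of the union of a chain already lies in one
    member of the chain. *)
Lemma noetherian_acc (C : set (set F)) : noetherian R -> C !=set0 ->
  total_on C subset ->
  (forall I, C I -> submod A I /\ I `<=` A) -> C (\bigcup_(I in C) I).
Proof.
move=> noeth [I0 CI0] Ctot CA; pose U := \bigcup_(I in C) I.
have Jid : ideal [set r | U (rho r)].
  split; first by exists I0; rewrite ?rmorph0//; apply: submod0 (CA _ CI0).1.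
  move=> a x y [I CI Ix] [I' CI' Iy] /=; rewrite rmorphD rmorphM.
  have Aa : A (rho a) by exists a.
  have [II'|II'] := Ctot _ _ CI CI'.
    by exists I' => //; case: (CA _ CI') => -[_ h] _; apply: h => //; apply: II'.
  by exists I => //; case: (CA _ CI) => -[_ h] _; apply: h => //; apply: II'.
have [s Js] := noeth _ Jid.
have [I CI sI] : exists2 I, C I & forall r, r \in s -> I (rho r).
  have : forall r, r \in s -> U (rho r).
    move=> r rs; suff : [set r | U (rho r)] r by [].
    by rewrite Js; apply: sub_gen_smallest.
  elim: (s) => [|r s' IH] hs; first by exists I0.
  have [|I CI sI] := IH; first by move=> x xs; apply: hs; rewrite inE xs orbT.
  have [I' CI' rI'] := hs r (mem_head _ _).
  have [II'|II'] := Ctot _ _ CI CI'.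
    exists I' => // x; rewrite inE => /predU1P[->//|/sI]; exact: II'.
  by exists I => // x; rewrite inE => /predU1P[->|/sI//]; exact: II'.
suff -> : \bigcup_(I in C) I = I by [].
apply/seteqP; split=> [x Ux|x Ix]; last by exists I.
have [r _ rx] : A x by have [I' CI' I'x] := Ux; apply: (CA _ CI').2.
have : [set r | U (rho r)] r by rewrite /= rx.
rewrite Js -rx; apply: (_ : ideal_span [set` s] `<=` [set r | I (rho r)]).
apply: smallest_sub; last by move=> z /= /sI.
split; first by rewrite /= rmorph0; apply: submod0 (CA _ CI).1.
move=> a z y Iz Iy /=; rewrite rmorphD rmorphM.
by case: (CA _ CI) => -[_ h] _; apply: h => //; exists a.
Qed.

Lemma maximal_idealE (M : set R) : maximal_ideal M -> M = [set r | vge v 1 (rho r)].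
Proof.
move=> [[M0 Mid] MT Mmax].
have MN : M `<=` [set r | vge v 1 (rho r)].
  move=> r Mr; apply: contrapT => nr; apply: MT; apply/seteqP; split=> // z _.
  have [r0 vr] := vge_unit (AO (imageT rho r)) nr.
  have [w _ wE] : A (rho r)^-1.
    by apply: (unit_inv hv Aint range_subring (@subset_refl _ _)) => //; exists r.
  suff -> : z = z * w * r + 0 by apply: Mid.
  by apply: rho_inj; rewrite addr0 !rmorphM wE mulfVK.
have [||->//|NT] := Mmax [set r | vge v 1 (rho r)] => //.
  split=> [|a x y vx vy] /=; first by rewrite rmorph0; left.
  by rewrite rmorphD rmorphM; apply: vgeD => //; apply: vgeMl => //; apply: AO;
    exists a.
have : [set r | vge v 1 (rho r)] 1 by rewrite NT.
by rewrite /= rmorph1 => /(vgeE (oner_neq0 _)); rewrite valuation1.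
Qed.

(** If [s^t O] is inside [A], an element whose valuation is large lies in a high
    power of the maximal ideal. A Cauchy sequence with a null power has
    valuations tending to infinity, so it is null. *)
Lemma analytically_ramified_unbounded s : A s -> s != 0 -> 1 <= v s ->
  analytically_ramified R -> ~ bounded A s O.
Proof.
move=> [s' _ sE] s0 vs [M Mmax [x x0 [n xn]]] [t bt]; apply: x0.
have ME := maximal_idealE Mmax.
have Ms : M s' by rewrite ME /= sE; right.
have [u ux] : exists u, x = cauchy_class u by exists (cauchy_repr x);
  rewrite cauchy_reprK.
(* the exponent [n.+1] avoids the degenerate case [n = 0] *)
have : u ^+ n.+1 \in @adic_null R M.
  by apply/cauchy_class_eq0; rewrite cauchy_classX -ux exprS xn mulr0.
move=> /adic_nullP nu; rewrite ux; apply/cauchy_class_eq0/adic_nullP => k.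
have [N hN] := nu (n.+1 * (`|v s| * (k + t)))%N.
exists N => i /hN; rewrite cauchy_seqX => /(ideal_exp_vge (v := v) (rho := rho) hv).
have RO z : O (rho z) by apply: AO; exists z.
rewrite rmorphXn => /(_ RO) h.
have {}h : vge v (n.+1 * (`|v s| * (k + t)))%N%:Z (rho (u i) ^+ n.+1).
  by apply: h => z; rewrite ME.
have skt0 : s ^+ (k + t) != 0 by rewrite expf_neq0.
have Oq : O (rho (u i) / s ^+ (k + t)).
  apply: (vge_root hv (ltn0Sn n)); rewrite exprMn exprVn.
  have e0 : (s ^+ (k + t)) ^+ n.+1 != 0 by rewrite expf_neq0.
  apply: (vge_dvd hv e0 _ h); rewrite -exprM valuationX//.
  have vn : v s = (`|v s|%N)%:R by rewrite natz gez0_abs//; move: vs; lia.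
  by rewrite {1}vn -mulrnA natz lez_nat mulnA mulnC.
have [r _ re] := bt _ Oq.
have -> : u i = s' ^+ k * r; last exact: ideal_exp_pow.
apply: rho_inj; rewrite rmorphM rmorphXn sE re exprD.
by field; rewrite !expf_neq0.
Qed.

End AnalyticallyRamified.

Lemma dense_subfield_of_ramified (V : idomainType) (p : nat) (hV : is_dvr V)
    (hp : p \in [pchar {fraction V}]) (R : idomainType) :
  noetherian R -> analytically_ramified R -> is_normalization V R ->
  exists Q : set {fraction V},
      [/\ is_subfield Q,
          [set: {fraction V}] = [set a%:F + q | a in [set: V] & q in Q] &
          [set: {fraction V}] <>
            subfield_span (Q `|` range (fun x : {fraction V} => x ^+ p))].
Proof.
move=> noeth ram [f finj frange]; have [v hv vO] := hV.
have VO (a : V) : vge v 0 a%:F.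
  have h : range (fun a : V => a%:F) a%:F by exists a.
  by rewrite vO in h.
have OV x : vge v 0 x -> exists a : V, x = a%:F.
  move=> Ox.
  have : range (fun a : V => a%:F) x by rewrite vO.
  by case=> a _ <-; exists a.
have /choice[iota iotaE] : forall r : R, exists a : V, f a = r%:F.
  move=> r; have : range f r%:F by rewrite frange; apply: integral_id.
  by case=> a _ <-; exists a.
have iota_add : zmod_morphism iota.
  by move=> r r'; apply: finj; rewrite rmorphB !iotaE rmorphB.
have iota_mul : monoid_morphism iota.
  split; first by apply: finj; rewrite iotaE !rmorph1.
  by move=> r r'; apply: finj; rewrite rmorphM !iotaE rmorphM.
pose iotaM : {rmorphism R -> V} := HB.pack iota
  (GRing.isZmodMorphism.Build R V iota iota_add)
  (GRing.isMonoidMorphism.Build R V iota iota_mul).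
pose rho : {rmorphism R -> {fraction V}} := @FracField.tofrac V \o iotaM.
have rho_inj : injective rho.
  move=> r r' /eqP; rewrite /rho /= tofrac_eq => /eqP e.
  by apply/eqP; rewrite -tofrac_eq -!iotaE e.
pose A : set {fraction V} := range rho.
have AO : A `<=` vge v 0 by move=> _ [r _ <-]; apply: VO.
have hA : subring A := range_subring rho.
have Aint x : vge v 0 x -> exists q, [/\ q \is monic, coefs A q & root q x].
  move=> /OV[a ->].
  have [q qm qa] : integralOver (fun r : R => r%:F) (f a).
    suff : range f (f a) by rewrite frange.
    by exists a.
  exists (map_poly rho q); split; first exact: monic_map.
    by move=> i; rewrite coef_map; exists q`_i.
  have qE : map_poly (fun r : R => r%:F) q = map_poly f (map_poly iotaM q).
    by rewrite -map_poly_comp; apply: eq_map_poly => r /=; rewrite iotaE.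
  have : root (map_poly iotaM q) a.
    by move: qa; rewrite /root qE horner_map -(rmorph0 f) (inj_eq finj).
  by move=> h; rewrite /rho map_poly_comp rmorph_root.
have Afrac x : vge v 0 x -> exists r, [/\ A r, r != 0 & A (r * x)].
  move=> /OV[a ->]; have [c [d [d0 e]]] := frac_quotient (f a).
  exists (rho d); split; first by exists d.
    by rewrite -(rmorph0 rho) (inj_eq rho_inj).
  exists c => //; rewrite /rho /= -rmorphM; congr (_ %:F).
  by apply: finj; rewrite rmorphM !iotaE e mulrC mulfVK// tofrac_eq0.
have Aacc C (C0 : C !=set0) (Ct : total_on C subset) :=
  noetherian_acc (rho := rho) noeth C0 Ct.
have [s [As s0 vs]] := exists_nonunit hv AO Afrac.
have [|[K [hK Kp [y Ky] Kd]]]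
  := bounded_or_dense hv hA AO Aint Afrac hp Aacc As s0 vs.
  by move=> bO; case: (analytically_ramified_unbounded hv rho_inj AO Aint As s0
    vs ram).
exists K; split; first exact/is_subfieldP.
  apply/seteqP; split=> // x _; have [z [k [/OV[a ->] Kk ->]]] := Kd x.
  by exists a => //; exists k.
move=> e; apply: Ky.
have : subfield_span (K `|` range (fun x : {fraction V} => x ^+ p)) y by rewrite -e.
apply; split; first exact/is_subfieldP.
by move=> z [//|[x _ <-]].
Qed.

(** * Derivations with a dense kernel *)

(** The universal property of the fraction field. *)
Lemma frac_lift (R : idomainType) (F : fieldType) (rho : {rmorphism R -> F}) :
  injective rho -> exists Phi : {rmorphism {fraction R} ->
    F}, forall r, Phi r%:F = rho r.
Proof.
move=> rinj; have rho0 b : b != 0 -> rho b != 0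
  by rewrite -(rmorph0 rho) (inj_eq rinj).
have /choice[g gP] : forall z : {fraction R}, exists ab : R * R,
    ab.2 != 0 /\ z = ab.1%:F / ab.2%:F.
  by move=> z; have [a [b [b0 e]]] := frac_quotient z; exists (a, b).
pose Phi z := rho (g z).1 / rho (g z).2.
have PhiE a b : b != 0 -> Phi (a%:F / b%:F) = rho a / rho b.
  move=> b0; have [d0 e] := gP (a%:F / b%:F); set d := (g _).2 in d0 e *.
  apply/eqP; rewrite /Phi eqr_div ?rho0// -!rmorphM (inj_eq rinj) -tofrac_eq
    !tofracM.
  by rewrite eq_sym -eqr_div ?tofrac_eq0// -e.
have Phi_add : zmod_morphism Phi.
  move=> x y; have [a [b [b0 ->]]] := frac_quotient x;
    have [c [d [d0 ->]]] := frac_quotient y.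
  have -> : a%:F / b%:F - c%:F / d%:F = (a * d - c * b)%:F / (b * d)%:F.
    by rewrite -mulNr addf_div ?tofrac_eq0// mulNr -!tofracM -tofracB.
  rewrite !PhiE ?mulf_neq0// rmorphB !rmorphM.
  by rewrite -[in RHS]mulNr addf_div ?rho0// mulNr.
have Phi_mul : monoid_morphism Phi.
  split; first by rewrite -(divr1 1) -tofrac1 PhiE ?oner_neq0// rmorph1 divr1.
  move=> x y; have [a [b [b0 ->]]] := frac_quotient x;
    have [c [d [d0 ->]]] := frac_quotient y.
  rewrite mulf_div -!tofracM !PhiE ?mulf_neq0// !rmorphM.
  by rewrite mulf_div.
pose PhiM : {rmorphism {fraction R} -> F} := HB.pack Phi
  (GRing.isZmodMorphism.Build {fraction R} F Phi Phi_add)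
  (GRing.isMonoidMorphism.Build {fraction R} F Phi Phi_mul).
exists PhiM => r /=.
by rewrite -[r%:F]divr1 -tofrac1 PhiE ?oner_neq0// rmorph1 divr1.
Qed.

Section DenseDerivation.
Variables (F : fieldType) (v : F -> int) (Q : set F) (D : F -> F) (y : F).
Hypothesis hv : discrete_valuation v.
Hypothesis hQ : subfield Q.
Hypothesis Qdense : forall x, exists a q, [/\ vge v 0 a, Q q & x = a + q].
Hypotheses (DD : {morph D : a b / a + b})
  (DM : forall a b, D (a * b) = D a * b + a * D b)
  (DQ : forall q, Q q -> D q = 0) (Dy : D y = 1).

Local Notation O := (vge v 0).
Let Qr : subring Q := subfieldB hQ.

Lemma derB a b : D (a - b) = D a - D b.
Proof. by apply: (addIr (D b)); rewrite -DD !subrK. Qed.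

Lemma derQ q x : Q q -> D (q * x) = q * D x.
Proof. by move=> Qq; rewrite DM DQ// mul0r add0r. Qed.

Lemma derV x : x != 0 -> D x^-1 = - (D x * x^-1 ^+ 2).
Proof.
move=> x0; have : D (x * x^-1) = 0 by rewrite mulfV// DQ//; apply: subring1.
rewrite DM => /eqP; rewrite addrC addr_eq0 => /eqP e.
by apply: (mulfI x0); rewrite e mulrN; congr (- _); field.
Qed.

(** If [t = a + q] with [v t = -1] and [a] in the valuation ring, then [v q =
    -1]. *)
Lemma dense_uniformizer : exists s, [/\ Q s, s != 0 & v s = 1].
Proof.
have [t t0 vt] := exists_val hv (- 1); have [a [q [Oa Qq tE]]] := Qdense t.
have qE : q = t + - a by rewrite tE addrAC subrr add0r.
have [|q0 vq] := valuation_dom hv t0 (_ : vge v _ (- a)).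
  by rewrite vt addNr; apply: vgeN.
rewrite -qE in q0 vq; exists q^-1; split; [exact: subfieldV|by rewrite invr_eq0|].
by rewrite valuationV// vq vt opprK.
Qed.

Variable s : F.
Hypotheses (Qs : Q s) (s0 : s != 0) (vs : v s = 1).

Lemma val_uniX n : v (s ^+ n) = n%:Z. Proof. by rewrite valuationX// vs natz. Qed.
Lemma QsX n : Q (s ^+ n). Proof. exact: subringX. Qed.
Lemma sX_neq0 n : s ^+ n != 0. Proof. by rewrite expf_neq0. Qed.

Lemma dense_approx (n : nat) x : exists2 q, Q q & vge v n%:Z (x - q).
Proof.
have [a [q [Oa Qq e]]] := Qdense (x / s ^+ n).
exists (s ^+ n * q); first by apply: subringM => //; apply: QsX.
rewrite (_ : _ - _ = s ^+ n * a); first by apply: vgeMr => //; right;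
  rewrite val_uniX.
by rewrite -[x](mulfVK (sX_neq0 n)) e; ring.
Qed.

(** Choose [q] in [Q] close to [w]; then [q y] has derivative [q], and
    subtracting an element of [Q] close to [q y] makes it small while keeping
    its derivative. *)
Lemma der_approx (n : nat) w : exists x, vge v n%:Z x /\ vge v n%:Z (D x - w).
Proof.
have [q Qq hq] := dense_approx n w; have [q' Qq' hq'] := dense_approx n (q * y).
exists (q * y - q'); split=> //.
by rewrite derB derQ// Dy mulr1 DQ// subr0 -opprB; apply: vgeN.
Qed.

Lemma der_div_sX n x : D (x / s ^+ n) = D x / s ^+ n.
Proof. by rewrite mulrC derQ; [rewrite mulrC|apply: subfieldV => //;
  apply: QsX]. Qed.

Lemma clear_denominators x : exists n, O (s ^+ n * x) /\ O (D (s ^+ n * x)).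
Proof.
have big z : exists n, forall m, (n <= m)%N -> O (s ^+ m * z).
  have [->|z0] := eqVneq z 0; first by exists 0%N => m _; rewrite mulr0; left.
  exists `|v z|%N => m hm; right.
  by rewrite valuationM ?sX_neq0// val_uniX; move: hm; lia.
have [n hn] := big x; have [m hm] := big (D x).
exists (maxn n m); rewrite (derQ _ (QsX _)); split; [apply: hn|apply: hm].
  exact: leq_maxl.
exact: leq_maxr.
Qed.

End DenseDerivation.

(** * The subring on which a derivation is integral *)

Section TwistedRing.
Variables (V : idomainType) (D : {fraction V} -> {fraction V}).
Local Notation F := {fraction V}.
Hypotheses (DD : {morph D : a b / a + b})
  (DM : forall a b, D (a * b) = D a * b + a * D b).

(** The elements of [V] with derivative in [V]. Encoding this ring as a subtype
    of [V] gives it its integral domain structure for free, since it is closed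
    under the inverse operation of [V], which is the identity on nonunits. *)
Definition twisted_pred : {pred V} := fun a => `[< range (fun a : V => a%:F) (D
  a%:F) >].

Lemma twisted_divring : divring_closed twisted_pred.
Proof.
have D1 : D 1 = 0 by apply: (addrI (D 1));
  rewrite addr0 -{3}[1]mulr1 DM mulr1 mul1r.
have D0 : D 0 = 0 by apply: (addrI (D 0)); rewrite -DD !addr0.
have DN a : D (- a) = - D a by apply: (addrI (D a)); rewrite -DD !subrr.
have tM a b : a \in twisted_pred -> b \in twisted_pred -> a * b \in twisted_pred.
  move=> /asboolP[c _ cE] /asboolP[d _ dE]; apply/asboolP.
  by exists (c * b + a * d) => //; rewrite tofracD !tofracM DM cE dE.
split.
- by apply/asboolP; exists 0 => //; rewrite tofrac1 D1 tofrac0.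
- move=> a b /asboolP[c _ cE] /asboolP[d _ dE]; apply/asboolP.
  by exists (c - d) => //; rewrite !tofracB DD DN cE dE.
move=> a b ta tb; apply: tM => //.
have [ub|nb] := boolP (b \is a GRing.unit); last by rewrite invr_out.
move: tb => /asboolP[d _ dE]; apply/asboolP.
have b0 : b%:F != 0 by rewrite tofrac_eq0; apply: contraTneq ub => ->;
  rewrite unitr0.
exists (- (d * b^-1 ^+ 2)) => //.
have bV : b^-1%:F = (b%:F)^-1 by apply: (mulfI b0);
  rewrite mulfV// -tofracM mulrV// tofrac1.
rewrite tofracN tofracM tofracXn bV dE; apply: (mulfI b0).
have : D (b%:F / b%:F) = 0 by rewrite mulfV// D1.
rewrite DM => /eqP; rewrite addrC addr_eq0 => /eqP ->.
by rewrite mulrN expr2 (mulrCA b%:F) mulVKf.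
Qed.

HB.instance Definition _ :=
  GRing.isDivringClosed.Build V twisted_pred twisted_divring.

Record twisted := Twisted {
  twisted_val :> V;
  _ : twisted_val \in twisted_pred
}.

HB.instance Definition _ := [isSub for twisted_val].
HB.instance Definition _ := [Choice of twisted by <:].
HB.instance Definition _ := [SubChoice_isSubIntegralDomain of twisted by <:].

Lemma exists_twisted_subring : exists (R : idomainType) (rho : {rmorphism R -> F}),
  injective rho /\ range rho = [set x | range (fun a : V => a%:F) x /\
    range (fun a : V => a%:F) (D x)].
Proof.
exists twisted, (@FracField.tofrac V \o (val : twisted -> V)); split.
  by move=> x x' /= /eqP; rewrite tofrac_eq => /eqP; apply: val_inj.
apply/seteqP; split=> [_ [x _ <-]|x [[a _ <-] ta]].
  by split; [exists (val x)|apply/asboolP; apply: (valP x)].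
by exists (Twisted (asboolT ta : a \in twisted_pred)).
Qed.

End TwistedRing.

Lemma local_ring_units (R : comNzRingType) (M : set R) : ideal M -> ~ M 1 ->
  (forall r, ~ M r -> exists r', r * r' = 1) -> maximal_ideal M /\ local_ring R.
Proof.
move=> hM M1 Mu.
have full I r : ideal I -> I r -> ~ M r -> I = setT.
  move=> [I0 Iid] Ir /Mu[r' rr']; apply/seteqP; split=> // z _.
  suff -> : z = z * r' * r + 0 by apply: Iid.
  by rewrite addr0 -mulrA [r' * r]mulrC rr' mulr1.
have MT : M <> setT by move=> MT; apply: M1; rewrite MT.
have Mmax : maximal_ideal M.
  split=> // I hI MI; have [IM|] := pselect (I `<=` M).
    by left; apply/seteqP; split.
  by move=> /existsNP[r /not_implyP[Ir nMr]]; right; apply: (full _ r).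
split=> //; exists M; split=> // M' [hM' M'T M'max].
have M'M : M' `<=` M.
  by move=> r M'r; apply: contrapT => nMr; apply: M'T; apply: (full _ r).
by case: (M'max M hM M'M) => // MT'; case: MT.
Qed.

Lemma int_min (T : Type) (P : T -> Prop) (f : T -> int) : (forall x, P x ->
  0 <= f x) ->
  (exists x, P x) -> exists2 x, P x & forall z, P z -> f x <= f z.
Proof.
move=> f0 [x Px].
have ex : exists n, `[< exists z, P z /\ f z = n%:Z >].
  by exists `|f x|%N; apply/asboolP; exists x; rewrite gez0_abs// f0.
have [n /asboolP[z [Pz zn]] nmin] := ex_minnP ex.
exists z => // w Pw; rewrite zn -(gez0_abs (f0 w Pw)) lez_nat.
by apply: nmin; apply/asboolP; exists w; rewrite gez0_abs// f0.
Qed.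

Section TwistedProperties.
Variables (F : fieldType) (v : F -> int) (Q : set F) (D : F -> F) (y : F) (p : nat).
Hypothesis hv : discrete_valuation v.
Hypothesis hQ : subfield Q.
Hypothesis Qdense : forall x, exists a q, [/\ vge v 0 a, Q q & x = a + q].
Hypotheses (DD : {morph D : a b / a + b})
  (DM : forall a b, D (a * b) = D a * b + a * D b)
  (DQ : forall q, Q q -> D q = 0) (Dp : forall x, D (x ^+ p) = 0) (Dy : D y = 1).
Hypothesis p_gt0 : (0 < p)%N.
Variables (R : idomainType) (rho : {rmorphism R -> F}).
Hypothesis rho_inj : injective rho.

Local Notation O := (vge v 0).
Hypothesis rhoE : range rho = [set x | O x /\ O (D x)].

Let Qr : subring Q := subfieldB hQ.
Let hO : subring O := vge_subring hv.

Lemma rho_lift x : O x -> O (D x) -> exists r, rho r = x.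
Proof.
move=> Ox ODx; have : range rho x by rewrite rhoE.
by case=> r _ <-; exists r.
Qed.

Lemma rho_vge r : O (rho r) /\ O (D (rho r)).
Proof. by have : range rho (rho r) by [exists r]; rewrite rhoE. Qed.

Lemma twisted_unit r : ~ vge v 1 (rho r) -> exists r', r * r' = 1.
Proof.
move=> nr; have [Or ODr] := rho_vge r.
have [r0 vr] := vge_unit Or nr.
have Oi : O (rho r)^-1 by right; rewrite valuationV// vr.
have [|r' e] := rho_lift Oi.
  rewrite (derV hQ DM DQ r0); apply: vgeN => //; apply: subringM => //.
  exact: subringX.
by exists r'; apply: rho_inj; rewrite rmorphM e mulfV// rmorph1.
Qed.

Let M : set R := [set r | vge v 1 (rho r)].

Lemma twisted_local : maximal_ideal M /\ local_ring R.
Proof.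
apply: local_ring_units; last exact: twisted_unit.
  split=> [|a z z' Mz Mz']; first by rewrite /M /= rmorph0; left.
  rewrite /M /= rmorphD rmorphM; apply: vgeD => //; apply: vgeMl => //.
  by case: (rho_vge a).
by rewrite /M /= rmorph1 => /(vgeE (oner_neq0 _)); rewrite valuation1.
Qed.

Section Uniformizer.
Variable s : F.
Hypotheses (Qs : Q s) (s0 : s != 0) (vs : v s = 1).

Let vsX n : v (s ^+ n) = n%:Z. Proof. exact: val_uniX. Qed.
Let sX0 n : s ^+ n != 0. Proof. exact: sX_neq0. Qed.
Let QsXn n : Q (s ^+ n). Proof. exact: QsX. Qed.

Let exists_rho_s : exists S, rho S = s.
Proof.
apply: rho_lift; first by right; rewrite vs.
by rewrite DQ//; left.
Qed.

(** [D] is linear over [Q], so dividing [x] by [s^n] divides [D x] by [s^n] too. *)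
Lemma twisted_divisible S n r : rho S = s -> vge v n%:Z (rho r) ->
  vge v n%:Z (D (rho r)) ->
  exists r', r = S ^+ n * r'.
Proof.
move=> Ss vr vDr; have [||r' e] := @rho_lift (rho r / s ^+ n).
- by apply: (vge_dvd hv (sX0 n) _ vr); rewrite vsX.
- rewrite (der_div_sX hQ DM DQ Qs).
  by apply: (vge_dvd hv (sX0 n) _ vDr); rewrite vsX.
by exists r'; apply: rho_inj; rewrite rmorphM rmorphXn Ss e mulrC mulfVK.
Qed.

Lemma twisted_approx (n : nat) : exists r, vge v n%:Z (rho r) /\
  vge v n%:Z (D (rho r) - 1).
Proof.
have [x [hx hDx]] := der_approx hv hQ Qdense DD DM DQ Dy Qs s0 vs n 1.
have [||r e] := @rho_lift x.
- exact: vgeW hx.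
- rewrite -(subrK 1 (D x)); apply: vgeD => //; last exact: vge1.
  exact: vgeW hDx.
by exists r; rewrite e.
Qed.

Lemma twisted_quotient_approx (n : nat) z x : x != 0 -> O (z / x) -> O x ->
  exists2 q, Q q /\ O q & vge v n%:Z (z - q * x).
Proof.
move=> x0 Ozx Ox.
have [q Qq hq] := dense_approx hv hQ Qdense Qs s0 vs n (z / x).
exists q; last first.
  rewrite (_ : z - q * x = (z / x - q) * x); first exact: vgeMr.
  by rewrite mulrBl mulfVK.
split=> //; rewrite -(subrK (z / x) q); apply: vgeD => //.
by rewrite -opprB; apply: vgeN => //; apply: vgeW hq.
Qed.

(** Some [s^n] is in [I]: take [x^p / u], with [x] in [I] nonzero and [u] a unit
    killed by [D]. Let [a] have smallest valuation in [I], and let [b] have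
    derivative of smallest valuation among the [z] in [I] divisible by [s^n] in
    [V]. Multiples of [a] by elements of [Q] reduce any element of [I] to one
    divisible by [s^n] in [V]; multiples of [b] then make the derivative
    divisible by [s^n] as well, which leaves a multiple of [s^n] in the ring. So
    [a], [b] and [s^n] generate [I]. *)
Lemma twisted_noetherian : noetherian R.
Proof.
move=> I [I0 Iid]; have [S Ss] := exists_rho_s.
have IM a x : I x -> I (a * x) by move=> Ix; rewrite -[_ * _]addr0; apply: Iid.
have IB x z : I x -> I z -> I (x - z) by move=> Ix Iz; rewrite addrC -mulN1r;
  apply: Iid.
suff [t tI It] : exists2 t : seq R, (forall r, r \in t -> I r)
  & I `<=` ideal_span [set` t].
  exists t; apply/seteqP; split=> //; apply: smallest_sub => //.
have [[x0 [Ix0 x0n]]|nI] := pselect (exists x, I x /\ x != 0); last first.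
  exists [::] => // r Ir; have [->|r0] := eqVneq r 0;
    first exact: (ideal_span_ideal [set` ([::] : seq R)]).1.
  by case: nI; exists r.
have rho0 r : r != 0 -> rho r != 0 by rewrite -(rmorph0 rho) (inj_eq rho_inj).
have [n In] : exists n, I (S ^+ n).
  have x1 := rho0 _ x0n; have xp0 : rho x0 ^+ p != 0 by rewrite expf_neq0.
  have vx : 0 <= v (rho x0 ^+ p) by apply: (vgeE xp0); apply: subringX;
    case: (rho_vge x0).
  exists `|v (rho x0 ^+ p)|%N; set n := `|_|%N.
  have [||c cE] := @rho_lift (s ^+ n / rho x0 ^+ p).
  - by right; rewrite valuationM ?invr_eq0// valuationV// vsX gez0_abs// subrr.
  - by rewrite (derQ DM DQ _ (QsXn n)) -exprVn Dp mulr0; left.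
  have -> : S ^+ n = c * x0 ^+ p.-1 * x0.
    apply: rho_inj; rewrite !rmorphM !rmorphXn Ss cE -mulrA -exprSr prednK//.
    by rewrite mulfVK.
  exact: IM.
have [a [Ia a0] amin] : exists2 a, I a /\ a != 0 & forall z, I z /\
  z != 0 -> v (rho a) <= v (rho z).
  apply: (@int_min _ (fun a => I a /\ a != 0) (fun a => v (rho a)));
    last by exists x0.
  by move=> z [_ z0]; apply: (vgeE (rho0 _ z0)); case: (rho_vge z).
pose J z := [/\ I z, vge v n%:Z (rho z) & ~ vge v n%:Z (D (rho z))].
have [b [Ib vb bmin]] : exists b, [/\ I b, vge v n%:Z (rho b) &
    forall z, J z -> D (rho b) != 0 /\ O (D (rho z) / D (rho b))].
  have [Jn|Jn] := pselect (exists z, J z); last first.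
    by exists 0; split=> [//||z Jz]; [rewrite rmorph0; left|case: Jn; exists z].
  have nD z : J z -> D (rho z) != 0.
    by move=> [_ _ nz]; apply/negP => /eqP e; apply: nz; rewrite e; left.
  have [|b Jb bmin] := @int_min _ J (fun z => v (D (rho z))) _ Jn.
    by move=> z Jz; apply: (vgeE (nD _ Jz)); case: (rho_vge z).
  have [Ib vb _] := Jb; exists b; split=> // z Jz.
  split; first exact: nD.
  by apply: (vge_dvd hv (nD _ Jb) (bmin _ Jz)); apply: vge_val.
exists [:: a; b; S ^+ n].
  by move=> r; rewrite !inE => /or3P[] /eqP->.
move=> z Iz; have [sp0 spid] := ideal_span_ideal [set` [:: a; b; S ^+ n]].
have gen r : r \in [:: a; b; S ^+ n] -> ideal_span [set` [:: a; b; S ^+ n]] r.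
  by move=> hr; apply: sub_gen_smallest.
have liftQ q : Q q -> O q -> exists r, rho r = q.
  by move=> Qq Oq; apply: rho_lift => //; rewrite DQ//; left.
have [||q [Qq Oq] hq] := @twisted_quotient_approx n (rho z) _ (rho0 _ a0).
- have [->|z0] := eqVneq z 0; first by rewrite rmorph0 mul0r; left.
  by apply: (vge_dvd hv (rho0 _ a0) (amin _ (conj Iz z0))); apply: vge_val.
- by case: (rho_vge a).
have [c cE] := liftQ _ Qq Oq.
pose z1 := z - c * a.
have Iz1 : I z1 by apply: IB => //; apply: IM.
have vz1 : vge v n%:Z (rho z1) by rewrite rmorphB rmorphM cE.
suff sz1 : ideal_span [set` [:: a; b; S ^+ n]] z1.
  rewrite (_ : z = c * a + z1); last by rewrite /z1 addrC subrK.
  by apply: (spid) => //; apply: gen; rewrite inE eqxx.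
have [vDz1|nDz1] := pselect (vge v n%:Z (D (rho z1))).
  have [r ->] := twisted_divisible Ss vz1 vDz1.
  rewrite mulrC -[_ * _]addr0; apply: (spid) => //; apply: gen.
  by rewrite !inE eqxx !orbT.
have [|Db0 Oz1b] := bmin z1; first by split.
have [|q' [Qq' Oq'] hq'] := twisted_quotient_approx n Db0 Oz1b.
  by case: (rho_vge b).
have [c' cE'] := liftQ _ Qq' Oq'.
pose z2 := z1 - c' * b.
have [||r z2E] := @twisted_divisible S n z2 Ss.
- by rewrite rmorphB rmorphM cE'; apply: vgeB => //; apply: vgeMl.
- by rewrite rmorphB rmorphM cE' (derB DD) (derQ DM DQ).
rewrite (_ : z1 = c' * b + z2); last by rewrite /z2 addrC subrK.
apply: (spid); first by apply: gen; rewrite !inE eqxx orbT.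
rewrite z2E mulrC -[_ * _]addr0; apply: (spid) => //; apply: gen.
by rewrite !inE eqxx !orbT.
Qed.

(** The nilpotent is the limit of elements [u n] with [u n] tending to 0 and [D
    (u n)] tending to 1 for [v]. Its square is null as [D (x ^ 2) = 2 x D x]. It
    is not null, because the derivatives of elements of the square of the
    maximal ideal have positive valuation. *)
Lemma twisted_ramified : analytically_ramified R.
Proof.
have [S Ss] := exists_rho_s; have [Mmax _] := twisted_local.
have MS : M S by rewrite /M /= Ss; right; rewrite vs.
have deep n r : vge v n%:Z (rho r) -> vge v n%:Z (D (rho r)) -> ideal_exp M n r.
  by move=> vr vDr; have [r' ->] := twisted_divisible Ss vr vDr;
    apply: ideal_exp_pow.
have [u uP] := choice twisted_approx.
have uc : u \in @adic_cauchy R M.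
  apply/adic_cauchyP => n; exists n => i j ni nj; apply: deep.
    rewrite rmorphB; apply: vgeB => //; [apply: vgeW (uP i).1|apply: vgeW (uP j).1];
    by rewrite lez_nat.
  rewrite rmorphB (derB DD) (_ : D _ - D _ = (D (rho (u i)) - 1) - (D (rho (u
    j)) - 1)); last by ring.
  by apply: vgeB => //; [apply: vgeW (uP i).2|apply: vgeW (uP j).2];
    rewrite lez_nat.
pose U := CauchySeq uc.
exists M => //; exists (cauchy_class U).
  move=> /cauchy_class_eq0/adic_nullP/(_ 2%N)[N hN].
  have : ideal_exp M 2 `<=` [set r | vge v 1 (rho r) /\ vge v 1 (D (rho r))].
    apply: smallest_sub.
      split=> [|a x z [vx vDx] [vz vDz]] /=.
        by rewrite rmorph0; split; [left|rewrite -(subrr 0) (derB DD) subrr; left].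
      have [Oa ODa] := rho_vge a.
      rewrite rmorphD rmorphM DD DM; split; first by apply: vgeD => //;
        apply: vgeMl.
      by apply: vgeD => //; apply: vgeD => //; [apply: vgeMl|apply: vgeMl].
    move=> _ [f Mf <-] /=; rewrite big_ord_recl big_ord1 rmorphM DM.
    have [O1 OD1] := rho_vge (f ord0);
      have [O2 OD2] := rho_vge (f (lift ord0 ord0)).
    split; first by apply: vgeMl => //; apply: Mf.
    by apply: vgeD => //; [apply: vgeMl => //; apply: Mf|apply: vgeMr => //;
      apply: Mf].
  move=> /(_ _ (hN (maxn N 1) (leq_maxl _ _)))[_ /= h1].
  have h2 : vge v 1 (D (rho (u (maxn N 1))) - 1).
    by apply: vgeW (uP _).2; rewrite lez_nat leq_maxr.
  have : vge v 1 1 by rewrite -(subKr (D (rho (u (maxn N 1)))) 1); apply: vgeB.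
  by move=> /(vgeE (oner_neq0 _)); rewrite valuation1.
exists 2%N; rewrite -cauchy_classX; apply/cauchy_class_eq0/adic_nullP => n.
exists n => i ni; rewrite cauchy_seqX /=; have [h1 h2] := uP i.
have [O1 OD1] := rho_vge (u i).
have {}h1 : vge v n%:Z (rho (u i)) by apply: vgeW h1; rewrite lez_nat.
apply: deep; rewrite rmorphXn expr2; first exact: vgeMl.
by rewrite DM; apply: vgeD => //; [apply: vgeMl|apply: vgeMr].
Qed.

End Uniformizer.
End TwistedProperties.

(** * From the subfield to the Noetherian ring *)

Lemma smallest_subfield (F : fieldType) (G : set F) : subfield (subfield_span G).
Proof.
have h K : is_subfield K /\ G `<=` K -> subfield K by case=> /is_subfieldP.
split; [split=> [K /h|x y Gx Gy K hK|x y Gx Gy K hK]|move=> x Gx K hK].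
- by move=> /subfieldB/subring1.
- by apply: (subringB (subfieldB (h _ hK))); [apply: Gx|apply: Gy].
- by apply: (subringM (subfieldB (h _ hK))); [apply: Gx|apply: Gy].
by apply: (subfieldV (h _ hK)); apply: Gx.
Qed.

(** The fraction field of [R] is identified with that of [V] through
    [frac_lift]; the monic equation of [a] over [R] is [X^p - a^p]. *)
Lemma normalization_intro (V R : idomainType) (v : {fraction V} -> int) (p : nat)
    (rho : {rmorphism R -> {fraction V}}) :
    discrete_valuation v -> range (fun a : V => a%:F) = vge v 0 -> (0 < p)%N ->
    injective rho -> range rho `<=` vge v 0 ->
    (forall a : V, range rho (a%:F ^+ p)) ->
    (forall x, exists a b, b != 0 /\ x = rho a / rho b) ->
  is_normalization V R.
Proof.
move=> hv VE p0 rinj rO rp rfrac.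
have [Phi PhiE] := frac_lift rinj.
have Phi_inj : injective Phi by apply: fmorph_inj.
have Phi_surj x : exists z, Phi z = x.
  have [a [b [b0 ->]]] := rfrac x; exists (a%:F / b%:F).
  by rewrite fmorph_div !PhiE.
have /choice[f fE] : forall a : V, exists z, Phi z = a%:F by move=> a;
  apply: Phi_surj.
have f_add : zmod_morphism f.
  by move=> a b; apply: Phi_inj; rewrite rmorphB !fE tofracB.
have f_mul : monoid_morphism f.
  split; first by apply: Phi_inj; rewrite fE tofrac1 rmorph1.
  by move=> a b; apply: Phi_inj; rewrite rmorphM !fE tofracM.
pose fM : {rmorphism V -> {fraction R}} := HB.pack f
  (GRing.isZmodMorphism.Build V {fraction R} f f_add)
  (GRing.isMonoidMorphism.Build V {fraction R} f f_mul).
exists fM.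
  by move=> a b /= e; apply/eqP; rewrite -tofrac_eq -!fE e.
apply/seteqP; split=> [_ [a _ <-]|z [q qm qz]] /=.
  have [r _ rE] := rp a; exists ('X^p - r%:P); first exact: monicXnsubC.
  rewrite rmorphB /= map_polyXn map_polyC /= rootE !hornerE.
  by rewrite subr_eq0; apply/eqP/Phi_inj; rewrite rmorphXn PhiE rE fE.
have OPz : vge v 0 (Phi z).
  apply: (vge_integral hv (q := map_poly rho q)); first exact: monic_map.
    by move=> i; rewrite coef_map; apply: rO; exists q`_i.
  have -> : map_poly rho q = map_poly Phi (map_poly (fun r : R => r%:F) q).
    by rewrite -map_poly_comp; apply: eq_map_poly => r /=; rewrite PhiE.
  by rewrite fmorph_root.
move: OPz; rewrite -VE => -[a _ aE]; exists a => //.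
by apply: Phi_inj; rewrite fE.
Qed.

Lemma ramified_of_dense_subfield (V : idomainType) (p : nat) (hV : is_dvr V)
    (hp : p \in [pchar {fraction V}]) (Q : set {fraction V}) :
  is_subfield Q ->
  [set: {fraction V}] = [set a%:F + q | a in [set: V] & q in Q] ->
  [set: {fraction V}] <>
    subfield_span (Q `|` range (fun x : {fraction V} => x ^+ p)) ->
  exists R : idomainType,
      [/\ noetherian R, local_ring R, analytically_ramified R &
          is_normalization V R].
Proof.
move=> /is_subfieldP hQ QV QF; have [v hv VE] := hV.
set K := subfield_span _ in QF; have hK : subfield K by apply: smallest_subfield.
have [y Ky] : exists y, ~ K y.
  apply: contrapT => nK; apply: QF; apply/seteqP; split=> // y _.
  by apply: contrapT => nKy; apply: nK; exists y.
have KQ q : Q q -> K q by move=> Qq L [_ sub]; apply: sub; left.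
have Kp x : K (x ^+ p) by move=> L [_ sub]; apply: sub; right; exists x.
have [D [DD DM DK Dy]] := exists_derivation hp hK Kp Ky.
have DQ q : Q q -> D q = 0 by move=> /KQ; apply: DK.
have Dp x : D (x ^+ p) = 0 by apply: DK.
have p0 := pchar_gt0 hp.
have Qdense x : exists a q, [/\ vge v 0 a, Q q & x = a + q].
  have : [set: {fraction V}] x by [].
  rewrite QV => -[a _ [q Qq <-]]; exists a%:F, q; split=> //.
  have : range (fun a : V => a%:F) a%:F by exists a.
  by rewrite VE.
have [s [Qs s0 vs]] := dense_uniformizer hv hQ Qdense.
have [R [rho [rinj rhoE]]] := exists_twisted_subring DD DM.
rewrite VE in rhoE.
have [_ Rlocal] := twisted_local hv hQ DM DQ rinj rhoE.
have Rnoeth := twisted_noetherian hv hQ Qdense DD DM DQ Dp p0 rinj rhoE Qs s0 vs.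
have Rram := twisted_ramified hv hQ Qdense DD DM DQ Dy rinj rhoE Qs s0 vs.
exists R; split=> //; apply: (normalization_intro hv VE p0 rinj).
- by rewrite rhoE => x [].
- move=> a; rewrite rhoE; split; last by rewrite Dp; left.
  apply: (subringX (vge_subring hv)).
  have : range (fun a : V => a%:F) a%:F by exists a.
  by rewrite VE.
move=> x; have [n [Ox ODx]] := clear_denominators hv hQ DM DQ Qs s0 vs x.
have [a aE] := rho_lift rhoE Ox ODx.
have [||b bE] := rho_lift rhoE (x := s ^+ n).
- by right; rewrite (val_uniX hv s0 vs).
- by rewrite DQ; [left|apply: QsX].
exists a, b; rewrite aE bE; split; last by rewrite mulrC mulKf// expf_neq0.
by rewrite -(inj_eq rinj) bE rmorph0 expf_neq0.
Qed.

Theorem theorem6p5 (V : idomainType) (p : nat) (hV : is_dvr V)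
    (hp : p \in [pchar {fraction V}]) :
  (exists R : idomainType,
      [/\ noetherian R, local_ring R, analytically_ramified R &
          is_normalization V R])
  <->
  (exists Q : set {fraction V},
      [/\ is_subfield Q,
          [set: {fraction V}] = [set a%:F + q | a in [set: V] & q in Q] &
          [set: {fraction V}] <>
            subfield_span (Q `|` range (fun x : {fraction V} => x ^+ p))]).
Proof.
split=> [[R [Rnoeth _ Rram VR]]|[Q [hQ QV QF]]].
  exact: (dense_subfield_of_ramified hV hp Rnoeth Rram VR).
exact: (ramified_of_dense_subfield hV hp hQ QV QF).
Qed.
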